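(* Let $f:\mathbb{R}^d\to\mathbb{R}$ be differentiable, let $\nabla f_\xi(x)$ denote the stochastic gradient at $x\in\mathbb{R}^d$ (a random vector in $\mathbb{R}^d$), assumed to have an absolutely continuous distribution. Suppose that for any $j\in\{1,\dots,d\}$ and any $x\in\mathbb{R}^d$ the marginal density $p_j$ of the $j$-th component $\nu_j$ of $\nu=\nabla f_\xi(x)-\nabla f(x)$ satisfies: (i) there exists $M_j>0$ such that $r_j(u)=(p_j(u)-p_j(-u))/2$ fulfils $\int_{-\infty}^{+\infty}u\,r_j(u)\,du=0$ and $\int_{-\infty}^{+\infty}u^2|r_j(u)|\,du\le M_j$; (ii) there are $B_j>0$ and $\beta_j\ge1$ such that, for any $k\in\mathbb{N}$ and all $u\in\mathbb{R}$, \[ s_j^{*k}(u)\le\frac{B_jk}{k^{(\beta_j+1)/\beta_j}+|u|^{1+\beta_j}},\qquad\text{where } s_j(u)=(p_j(u)+p_j(-u))/2 . \] Let $\theta>0$ and let $m,n$ be positive integers such that $m>2+3/\beta_j$ and $\theta^2n\ge\max\{2,m^2\}M_j$ for all $j\in\{1,\dots,d\}$. Then \[ \mathbb{E}\big\|\mathrm{SMoM}_{m,n}(\nabla f_\xi(x),\theta)-\nabla f(x)\big\|^2\lesssim m\Bigg\{(1+\theta^2)d+\sum_{j=1}^d\Bigg[\left(\frac{M_j}{\theta n}\right)^2+\left(\frac{2^{\beta_j}B_j}{\beta_jn^{\beta_j-1}}\right)^{2/\beta_j}+\left(\frac{B_jM_j}{\theta n^{\beta_j}}\right)^{2/(\beta_j+1)}\Bigg]\Bigg\}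 \] and \[ \big\|\mathbb{E}\,\mathrm{SMoM}_{m,n}(\nabla f_\xi(x),\theta)-\nabla f(x)\big\|\lesssim\frac{m(1+\theta)}{\theta^2n}\sqrt{\sum_{j=1}^dM_j^2}+\frac{m}{\theta^2n}\sqrt{\sum_{j=1}^dM_j^2\left(\frac{2^{\beta_j}B_j}{n^{\beta_j-1}}\right)^{2/\beta_j}} . \]
   Context: $\|\cdot\|$ is the Euclidean norm. $g\lesssim h$ means $g\le Ch$ for a universal constant $C>0$. $g^{*k}$ denotes the $k$-fold convolution of $g$ with itself, $g*h(u)=\int g(u-v)h(v)\,dv$. Smoothed median of means: for a random element $\zeta$ in $\mathbb{R}^d$, $\theta>0$ and positive integers $m,n$, let $\zeta_1,\dots,\zeta_{(2m+1)n}$ be i.i.d. copies of $\zeta$ and let $\eta_1,\dots,\eta_{2m+1}\sim\mathcal{N}(0,I_d)$ be independent standard Gaussian vectors (independent of the $\zeta_i$). For $j\in\{0,\dots,2m\}$ put $\upsilon_{j}=\frac1n\sum_{i=1}^{n}\zeta_{jn+i}+\theta\,\eta_{j+1}$. Then $\mathrm{SMoM}_{m,n}(\zeta,\theta)=\mathrm{Med}(\upsilon_0,\dots,\upsilon_{2m})$, where $\mathrm{Med}$ of $2m+1$ vectors is the $(m+1)$-th order statistic taken component-wise. *)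

(* Defs.v *)
From HB Require Import structures.
From mathcomp Require Import all_boot all_order all_algebra.
From mathcomp Require Import all_classical all_reals all_analysis.

Set Implicit Arguments.
Unset Strict Implicit.
Unset Printing Implicit Defensive.

Import Order.TTheory GRing.Theory Num.Theory.
Import numFieldNormedType.Exports.

Local Open Scope classical_set_scope.
Local Open Scope ring_scope.

(* 'rV[T]_n carries the sigma-algebra generated by its coordinates; for T = R
   this is the Borel sigma-algebra of R^n. The construction mirrors the
   library's one for n.-tuple T. *)
Definition rV_display : measure_display -> measure_display.
Proof. exact. Qed.

Section measurable_rV.
Context {d} {T : sigmaRingType d}.
Variable n : nat.

Let coors : 'I_n -> 'rV[T]_n -> T := fun j x => x ord0 j.

Let rV_set0 : g_sigma_preimage coors set0.
Proof. exact: sigma_algebra0. Qed.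

Let rV_setC A : g_sigma_preimage coors A -> g_sigma_preimage coors (~` A).
Proof. exact: sigma_algebraC. Qed.

Let rV_bigcup (F : _^nat) : (forall i, g_sigma_preimage coors (F i)) ->
  g_sigma_preimage coors (\bigcup_i (F i)).
Proof. exact: sigma_algebra_bigcup. Qed.

HB.instance Definition _ := @isMeasurable.Build (rV_display d)
  'rV[T]_n (g_sigma_preimage coors) rV_set0 rV_setC rV_bigcup.

End measurable_rV.

(* The library's norm on 'rV[R]_d is the sup norm. *)
Definition norm2 {R : realType} {d : nat} (u : 'rV[R]_d) : R :=
  Num.sqrt (\sum_(j < d) u ord0 j ^+ 2).

Definition gradient {R : realType} {d : nat} (f : 'rV[R]_d -> R)
    (x : 'rV[R]_d) : 'rV[R]_d :=
  \row_j 'D_(delta_mx ord0 j) f x.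

(* Lebesgue measure on R^n as an iterated product with the one-dimensional
   Lebesgue measure (same slicing formula as the library's \x). *)
Fixpoint lebesgue_rV {R : realType} (n : nat) : set 'rV[R]_n -> \bar R :=
  match n with
  | 0 => \d_(0 : 'rV[R]_0)
  | n'.+1 => fun A => (\int[lebesgue_measure]_t
      lebesgue_rV [set u : 'rV[R]_n' | A (row_mx (const_mx t : 'rV[R]_1) u)])%E
  end.

Section random_vectors.
Context {d : measure_display} {T : measurableType d} {R : realType}.
Variable P : probability T R.

Definition has_density (Y : T -> R) (p : R -> R) : Prop :=
  [/\ measurable_fun [set: R] p,
      forall u, 0 <= p u &
      forall A : set R, measurable A ->
        P (Y @^-1` A) = (\int[lebesgue_measure]_(u in A) (p u)%:E)%E].

(* Product rule over the full family; subfamilies are obtained by taking the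
   other [A i] equal to [setT]. *)
Definition mutually_independent {d'} {T' : measurableType d'} (I : finType)
    (X : I -> T -> T') : Prop :=
  forall A : I -> set T', (forall i, measurable (A i)) ->
    P [set w | forall i, A i (X i w)] = (\prod_i P (X i @^-1` A i))%E.

(* X ~ N(0, I_k): the law of X is the k-fold product of N(0, 1). *)
Definition standard_gaussian {k : nat} (X : T -> 'rV[R]_k) : Prop :=
  forall A : 'I_k -> set R, (forall j, measurable (A j)) ->
    P [set w | forall j, A j (X w ord0 j)] =
    (\prod_j normal_prob 0 1 (A j))%E.

(* For integrable components this is the usual expectation of a vector. *)
Definition vexpectation {k : nat} (X : T -> 'rV[R]_k) : 'rV[R]_k :=
  \row_j fine ('E_P[fun w => X w ord0 j])%E.

End random_vectors.

Section densities.
Context {R : realType}.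

(* Extended-real valued, so that a divergent convolution integral has value
   +oo and violates any finite upper bound. *)
Definition convolution (g h : R -> \bar R) (u : R) : \bar R :=
  (\int[lebesgue_measure]_v (g (u - v)%R * h v))%E.

(* The k-fold convolution g^{*k}; meaningful for k > 0. *)
Definition convolution_pow (g : R -> \bar R) (k : nat) : R -> \bar R :=
  iter k.-1 (convolution g) g.

Definition even_part (p : R -> R) (u : R) : R := (p u + p (- u)) / 2.
Definition odd_part (p : R -> R) (u : R) : R := (p u - p (- u)) / 2.

End densities.

Section smoothed_median_of_means.
Context {R : realType} {d : nat}.

(* The sequence is indexed from 0, so the (m+1)-th order statistic has
   index m. *)
Definition med (m : nat) (v : 'I_(2 * m).+1 -> 'rV[R]_d) : 'rV[R]_d :=
  \row_j nth 0 (sort <=%R [seq v i ord0 j | i : 'I_(2 * m).+1]) m.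

(* zeta_1, zeta_2, ... and eta_1, eta_2, ... are numbered from 0; only
   the first (2m+1)n, respectively 2m+1, terms are used. *)
Definition smom (T : Type) (m n : nat) (theta : R)
    (zeta eta : nat -> T -> 'rV[R]_d) (w : T) : 'rV[R]_d :=
  med (fun j : 'I_(2 * m).+1 =>
    n%:R^-1 *: (\sum_(i < n) zeta (j * n + i)%N w) + theta *: eta j w).

End smoothed_median_of_means.

Definition smom_inputs (V : Type) (m n : nat) (zeta eta : nat -> V)
    (k : 'I_((2 * m).+1 * n) + 'I_(2 * m).+1) : V :=
  match k with inl i => zeta i | inr j => eta j end.

(* Main.v *)
Require Import Defs.
From HB Require Import structures.
From mathcomp Require Import all_boot all_order all_algebra.
From mathcomp Require Import all_classical all_reals all_analysis.
From mathcomp Require Import measurable_realfun.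
From mathcomp Require Import ring lra zify.

Set Implicit Arguments.
Unset Strict Implicit.
Unset Printing Implicit Defensive.

Import Order.TTheory GRing.Theory Num.Theory.
Import numFieldNormedType.Exports.

Local Open Scope classical_set_scope.
Local Open Scope ring_scope.

(* Fix a coordinate, let p = s + r be the even and odd parts of the density of
   the noise, S the sum of n copies of the noise, X = S / n + theta eta. The
   function r has vanishing moments of order 0 and 1, so replacing one factor p
   by s changes the mean of a test function g by at most K M, where K h^2 bounds
   the first-order Taylor remainder of g; n replacements cost n K M (Lindeberg).
   - Taking for g a bump at scale n t compares P(|S| / n > t) with the tail of
     s^{*n}, and yields P(|X| > t) <= C (D + theta) / t with
     D^beta = 2^beta B / (beta n^(beta - 1)).
   - Taking g(S) = P(X > t | S) + P(X >= -t | S), for which K is of order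
     1 / (n theta)^2 thanks to the Gaussian, and whose mean is 1 under the
     symmetric law s^{*n}, yields |P(X > t) - P(X < -t)| <= 4 M / (theta^2 n).
   The median exceeds t when at least m + 1 of 2 m + 1 independent copies of X
   do; both bounds pass to the median through binomial tails, and the moments
   follow by integration over t. *)

(** * Invariance of Lebesgue measure; densities *)

(** The even part [s] may have no mean, let alone a variance (Cauchy tails are allowed), so [S] is
    out of reach of moment inequalities. Only the odd part has a second moment, and it is the only
    thing against which a Taylor expansion is integrated. This is why test functions are bounded
    with a first-order remainder, and why most integrals are of nonnegative extended-real functions.
    The tail bound [C (D + theta) / t] for one block does not even give a mean. The median repairs
    this: the binomial tail raises it to the power [m + 1], and [m >= 3] makes this at least a
    fourth power, enough for a second moment. The factor [2 ^ (2 m + 1)] of the binomial bound is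
    absorbed by a scale four times larger, so nothing exponential in [m] survives. For the bias, the
    two tails of the median are compared rather than bounded: their difference is that of one block,
    at most [4 M / (theta^2 n)], times a factor of order [m], and for [t] above the scale also times
    [(scale / t)^m]. The integral over [t] is then of order [m M (D + theta) / (theta^2 n)]. *)

Section lebesgue_invariance.
Context {R : realType}.
Local Notation mu := (@lebesgue_measure R).
Local Open Scope ereal_scope.

(** Translation keeps the length of []x, y]], and these lengths determine the measure. *)
Lemma lebesgue_measureD (a : R) (A : set R) : measurable A ->
  pushforward mu (fun x : measurableTypeR R => (x + a)%R : measurableTypeR R) A
  = mu A.
Proof.
move=> mA.
have mf : measurable_fun [set: measurableTypeR R]
  (fun x : measurableTypeR R => (x + a)%R : measurableTypeR R).
  exact: measurable_funD.
pose f : {mfun measurableTypeR R >-> measurableTypeR R} :=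
  HB.pack (fun x : measurableTypeR R => (x + a)%R : measurableTypeR R)
   (isMeasurableFun.Build _ _ _ _ _ mf).
apply/esym/(@lebesgue_measure_unique R (pushforward mu f)) => //= _ [[x y]] _ <-.
rewrite /pushforward/= (_ : _ @^-1` _ = `](x - a)%R, (y - a)%R]%classic).
  rewrite !lebesgue_measure_itv/= !lte_fin ltrD2r -!EFinB.
  by have -> : (y - a - (x - a) = y - x)%R by ring.
by apply/seteqP; split => z /=; rewrite !in_itv/= ltrBlDr lerBrDr.
Qed.

Lemma ge0_integral_shift (f : R -> \bar R) (a : R) :
  measurable_fun [set: R] f -> (forall x, 0 <= f x) ->
  \int[mu]_x f (x + a)%R = \int[mu]_x f x.
Proof.
move=> mf f0.
have mD : measurable_fun [set: measurableTypeR R]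
  (fun x : measurableTypeR R => (x + a)%R : measurableTypeR R).
  exact: measurable_funD.
transitivity (\int[pushforward mu
  (fun x : measurableTypeR R => (x + a)%R : measurableTypeR R)]_x f x).
  by rewrite (ge0_integral_pushforward mD).
by apply: eq_measure_integral => A mA _; exact: lebesgue_measureD.
Qed.

Lemma ge0_integral_opp (f : R -> \bar R) :
  measurable_fun [set: R] f -> (forall x, 0 <= f x) ->
  \int[mu]_x f (- x)%R = \int[mu]_x f x.
Proof.
move=> mf f0.
have mN : measurable_fun [set: measurableTypeR R]
  (-%R : measurableTypeR R -> measurableTypeR R) by [].
transitivity (\int[pushforward mu (-%R : _ -> measurableTypeR R)]_x f x).
  by rewrite (ge0_integral_pushforward mN).
by apply: eq_measure_integral => A mA _; exact: lebesgue_measureN.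
Qed.

End lebesgue_invariance.

Section density.
Context d (T : measurableType d) (R : realType).
Variables (mu nu : {measure set T -> \bar R}) (p : T -> R).
Hypothesis mp : measurable_fun [set: T] p.
Hypothesis p0 : forall x, 0 <= p x.
Hypothesis nup : forall A, measurable A ->
  nu A = (\int[mu]_(x in A) (p x)%:E)%E.
Local Open Scope ereal_scope.
Import HBNNSimple.

(** Monotone convergence along simple functions reduces the identity to level sets, where it is the
    hypothesis on [nu]. *)
Lemma ge0_integral_density (f : T -> \bar R) :
  measurable_fun [set: T] f -> (forall x, 0 <= f x) ->
  \int[nu]_x f x = \int[mu]_x (f x * (p x)%:E).
Proof.
move=> mf f0; have mE := @measurableT _ T.
have mg : measurable_fun [set: T] (EFin \o p) by exact/measurable_EFinP.
pose h := nnsfun_approx mE mf.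
have -> : \int[nu]_x f x = lim (\int[nu]_x (EFin \o h n) x @[n --> \oo]).
  have fE x : f x = lim ((EFin \o h n) x @[n --> \oo]).
    by apply/esym/cvg_lim => //; exact: cvg_nnsfun_approx.
  under eq_integral => x _ do rewrite fE.
  apply: monotone_convergence => //.
  - by move=> n; exact/measurable_EFinP.
  - by move=> n x Ex //=; rewrite lee_fin.
  - by move=> x Ex a b ab; rewrite lee_fin; exact/lefP/nd_nnsfun_approx.
have -> : \int[mu]_x (f x * (p x)%:E) =
    lim (\int[mu]_x ((h n x)%:E * (p x)%:E) @[n --> \oo]).
  have fg x : f x * (p x)%:E = lim (((h n x)%:E * (p x)%:E) @[n --> \oo]).
    apply/esym/cvg_lim => //; apply: cvgeZr => //.
    exact: cvg_nnsfun_approx.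
  under eq_integral => x _ do rewrite fg.
  apply: monotone_convergence => //.
  - by move=> n; apply/emeasurable_funM => //; exact/measurable_EFinP.
  - by move=> n x Ex /=; rewrite mule_ge0 ?lee_fin.
  - move=> x Ex a b ab/=; rewrite lee_wpmul2r ?lee_fin//.
    exact/lefP/nd_nnsfun_approx.
suff suf n : \int[mu]_x ((h n x)%:E * (p x)%:E) = \int[nu]_x (EFin \o h n) x.
  by congr (lim (_ @ \oo)); apply/funext => n; rewrite suf.
transitivity (\int[nu]_x
   (\sum_(y \in range (h n)) (y * \1_(h n @^-1` [set y]) x)%:E)); last first.
  by apply: eq_integral => t tE; rewrite /= fimfunE -fsumEFin.
have indich m r : measurable_fun [set: T] (fun x => (r * \1_(h m @^-1` [set r]) x)%:E).
  by apply: (measurable_comp measurableT) => //; exact: measurable_funM.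
rewrite ge0_integral_fsum//; last by move=> m y Ey; exact: nnfun_muleindic_ge0.
transitivity (\int[mu]_x (\sum_(y \in range (h n))
    (y * \1_(h n @^-1` [set y]) x)%:E * (p x)%:E)).
  under [RHS]eq_integral => x xE.
    rewrite -ge0_mule_fsuml => [|y]; last exact: nnfun_muleindic_ge0.
    rewrite fsumEFin // -(fimfunE _ x); over.
  by [].
rewrite ge0_integral_fsum//; last 2 first.
  - by move=> y; exact: emeasurable_funM.
  - by move=> m y Ey; rewrite mule_ge0 ?lee_fin// -lee_fin nnfun_muleindic_ge0.
apply: eq_fsbigr => r rhn.
have [r0|r0] := ltP r 0%R.
  rewrite preimage_nnfun0//.
  rewrite !integral0_eq// => x _; rewrite indicE in_set0 mulr0 ?mul0e//.
under [RHS]eq_integral do rewrite EFinM.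
rewrite integralZl_indic_nnsfun => //.
under eq_integral do rewrite EFinM -muleA.
rewrite ge0_integralZl//.
- rewrite integral_indic//= setIT nup// [in RHS]integral_mkcond.
  congr (_ * _); apply: eq_integral => x _.
  rewrite patchE indicE; case: ifPn => xA; first by rewrite mul1e.
  by rewrite mul0e.
- by apply: emeasurable_funM => //; exact/measurable_EFinP/measurable_indic.
- by move=> x _; rewrite mule_ge0 ?lee_fin.
Qed.

End density.

(** * Averaging against a density *)

Section averaging_operator.
Context {R : realType}.
Local Notation mu := (@lebesgue_measure R).
Local Open Scope ereal_scope.

Implicit Types (q p s : R -> R) (g h : R -> \bar R).

(* Extended-real valued, so that Tonelli applies without integrability side
   conditions. *)
Definition averaging (q : R -> R) (g : R -> \bar R) (x : R) : \bar R :=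
  \int[mu]_v (g (x + v)%R * (q v)%:E).

Lemma averaging_ge0 q g : (forall v, 0 <= q v)%R -> (forall x, 0 <= g x) ->
  forall x, 0 <= averaging q g x.
Proof.
by move=> q0 g0 x; apply: integral_ge0 => v _; rewrite mule_ge0 ?lee_fin.
Qed.

Lemma measurable_averaging_integrand q g x : measurable_fun [set: R] q ->
  measurable_fun [set: R] g ->
  measurable_fun [set: R] (fun v => g (x + v)%R * (q v)%:E).
Proof.
move=> mq mg; apply: emeasurable_funM; last exact/measurable_EFinP.
by apply: (measurableT_comp mg); exact: measurable_funD.
Qed.

Lemma measurable_averaging q g : measurable_fun [set: R] q ->
  measurable_fun [set: R] g -> (forall v, 0 <= q v)%R ->
  (forall x, 0 <= g x) -> measurable_fun [set: R] (averaging q g).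
Proof.
move=> mq mg q0 g0.
apply: (@measurable_fun_fubini_tonelli_F _ _ _ _ _ mu
  (fun z : R * R => g (z.1 + z.2)%R * (q z.2)%:E)).
  apply: emeasurable_funM.
    by apply: (measurableT_comp mg); exact: measurable_funD.
  by apply/measurable_EFinP; exact: measurableT_comp.
by move=> z; rewrite mule_ge0 ?lee_fin.
Qed.

Lemma averaging_le q g h : measurable_fun [set: R] q ->
  measurable_fun [set: R] g -> measurable_fun [set: R] h ->
  (forall v, 0 <= q v)%R -> (forall x, 0 <= g x) -> (forall x, g x <= h x) ->
  forall x, averaging q g x <= averaging q h x.
Proof.
move=> mq mg mh q0 g0 gh x; apply: ge0_le_integral => //.
- by move=> v _; rewrite mule_ge0 ?lee_fin.
- exact: measurable_averaging_integrand.
- exact: measurable_averaging_integrand.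
- by move=> v _; rewrite lee_wpmul2r ?lee_fin.
Qed.

Lemma averaging_addr q g (c : R) : measurable_fun [set: R] q ->
  measurable_fun [set: R] g -> (forall v, 0 <= q v)%R -> (forall x, 0 <= g x) ->
  \int[mu]_v (q v)%:E = 1 -> (0 <= c)%R ->
  averaging q (fun x => g x + c%:E) = (fun x => averaging q g x + c%:E).
Proof.
move=> mq mg q0 g0 q1 c0; apply/funext => x; rewrite /averaging.
under eq_integral do rewrite ge0_muleDl ?lee_fin//.
rewrite ge0_integralD//=; last 4 first.
- by move=> v _; rewrite mule_ge0 ?lee_fin.
- exact: measurable_averaging_integrand.
- by move=> v _; rewrite lee_fin mulr_ge0.
- by apply: emeasurable_funM => //; exact/measurable_EFinP.
rewrite ge0_integralZl_EFin//= ?q1 ?mule1//.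
- by move=> v _; rewrite lee_fin.
- exact/measurable_EFinP.
Qed.

(** Tonelli and the commutativity of addition. The exchange of factors in [iter_averaging_cmp] rests
    on it. *)
Lemma averagingC (q1 q2 : R -> R) g : measurable_fun [set: R] q1 ->
  measurable_fun [set: R] q2 -> measurable_fun [set: R] g ->
  (forall v, 0 <= q1 v)%R -> (forall v, 0 <= q2 v)%R -> (forall x, 0 <= g x) ->
  averaging q1 (averaging q2 g) = averaging q2 (averaging q1 g).
Proof.
move=> mq1 mq2 mg q10 q20 g0; apply/funext => x; rewrite /averaging.
transitivity (\int[mu]_v \int[mu]_w (g (x + v + w)%R * (q2 w)%:E * (q1 v)%:E)).
  apply: eq_integral => v _; rewrite ge0_integralZr ?lee_fin//.
    exact: measurable_averaging_integrand.
  by move=> w _; rewrite mule_ge0 ?lee_fin.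
rewrite (@fubini_tonelli _ _ _ _ _ mu mu
  (fun z : R * R => g (x + z.1 + z.2)%R * (q2 z.2)%:E * (q1 z.1)%:E)); last 2 first.
- apply: emeasurable_funM; last first.
    by apply/measurable_EFinP; exact: measurableT_comp.
  apply: emeasurable_funM.
    apply: (measurableT_comp mg); apply: measurable_funD => //.
    exact: measurable_funD.
  by apply/measurable_EFinP; exact: measurableT_comp.
- by move=> z; rewrite !mule_ge0 ?lee_fin.
apply: eq_integral => w _ /=.
rewrite -ge0_integralZr ?lee_fin//.
- by apply: eq_integral => v _; rewrite addrAC muleAC.
- exact: measurable_averaging_integrand.
- by move=> v _; rewrite mule_ge0 ?lee_fin.
Qed.

Section iterates.
Variable q : R -> R.
Hypothesis mq : measurable_fun [set: R] q.
Hypothesis q0 : forall v, (0 <= q v)%R.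

Lemma measurable_iter_averaging n g : measurable_fun [set: R] g ->
  (forall x, 0 <= g x) ->
  measurable_fun [set: R] (iter n (averaging q) g) /\
  (forall x, 0 <= iter n (averaging q) g x).
Proof.
move=> mg g0; elim: n => [//|n [IHm IH0]]; split => /=.
  exact: measurable_averaging.
exact: averaging_ge0.
Qed.

Lemma iter_averaging_le n g h : measurable_fun [set: R] g ->
  measurable_fun [set: R] h -> (forall x, 0 <= g x) -> (forall x, g x <= h x) ->
  forall x, iter n (averaging q) g x <= iter n (averaging q) h x.
Proof.
move=> mg mh g0 gh; have h0 x : 0 <= h x by exact: le_trans (gh x).
elim: n => [//|n IH] /= x.
have [? ?] := measurable_iter_averaging n mg g0.
have [? ?] := measurable_iter_averaging n mh h0.
exact: averaging_le.
Qed.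

Lemma iter_averaging_addr n g (c : R) : measurable_fun [set: R] g ->
  (forall x, 0 <= g x) -> \int[mu]_v (q v)%:E = 1 -> (0 <= c)%R ->
  iter n (averaging q) (fun x => g x + c%:E) =
  (fun x => iter n (averaging q) g x + c%:E).
Proof.
move=> mg g0 q1 c0; elim: n => [//|n IH] /=.
rewrite IH; have [? ?] := measurable_iter_averaging n mg g0.
exact: averaging_addr.
Qed.

Lemma iter_averagingC n (q' : R -> R) g : measurable_fun [set: R] q' ->
  (forall v, (0 <= q' v)%R) -> measurable_fun [set: R] g ->
  (forall x, 0 <= g x) ->
  iter n (averaging q) (averaging q' g) = averaging q' (iter n (averaging q) g).
Proof.
move=> mq' q'0 mg g0; elim: n => [//|n IH] /=.
rewrite IH; have [? ?] := measurable_iter_averaging n mg g0.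
exact: averagingC.
Qed.

Lemma measurable_convolution_pow k : (0 < k)%N ->
  measurable_fun [set: R] (convolution_pow (EFin \o q) k) /\
  (forall x, 0 <= convolution_pow (EFin \o q) k x).
Proof.
case: k => // k _; rewrite /convolution_pow/=.
elim: k => [|k [IHm IH0]] /=.
  by split=> [|x]; [exact/measurable_EFinP|rewrite lee_fin].
split; last by move=> x; apply: integral_ge0 => v _; rewrite mule_ge0 ?lee_fin.
apply: (@measurable_fun_fubini_tonelli_F _ _ _ _ _ mu
  (fun z : R * R => (q (z.1 - z.2))%:E * iter k (convolution (EFin \o q)) (EFin \o q) z.2)).
  apply: emeasurable_funM.
    apply/measurable_EFinP/(measurableT_comp mq).
    exact: measurable_funB.
  exact: measurableT_comp.
by move=> z; rewrite mule_ge0 ?lee_fin.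
Qed.

(** Links the operator that computes the law of a sum with the convolutions of hypothesis (ii): by
    Tonelli, a convolution factor moves onto [g] as one averaging. *)
Lemma integral_convolution_pow k g : (0 < k)%N -> measurable_fun [set: R] g ->
  (forall x, 0 <= g x) ->
  \int[mu]_v (g v * convolution_pow (EFin \o q) k v) = iter k (averaging q) g 0%R.
Proof.
case: k => // k _; elim: k g => [|k IH] g mg g0.
  by apply: eq_integral => v _; rewrite add0r.
rewrite iterSr -IH; last 2 first.
- exact: measurable_averaging.
- exact: averaging_ge0.
rewrite /convolution_pow/=.
set c := iter k _ _.
have [mc c0] : measurable_fun [set: R] c /\ forall x, 0 <= c x.
  exact: (@measurable_convolution_pow k.+1).
transitivity (\int[mu]_u \int[mu]_v (g u * ((q (u - v))%:E * c v))).
  apply: eq_integral => u _; rewrite ge0_integralZl//.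
    apply: emeasurable_funM => //; apply/measurable_EFinP/(measurableT_comp mq).
    exact: measurable_funB.
  by move=> v _; rewrite mule_ge0 ?lee_fin.
rewrite (@fubini_tonelli _ _ _ _ _ mu mu
  (fun z : R * R => g z.1 * ((q (z.1 - z.2))%:E * c z.2))); last 2 first.
- apply: emeasurable_funM; first exact: measurableT_comp.
  apply: emeasurable_funM; last exact: measurableT_comp.
  apply/measurable_EFinP/(measurableT_comp mq).
  exact: measurable_funB.
- by move=> z; rewrite !mule_ge0 ?lee_fin.
apply: eq_integral => v _ /=.
rewrite /averaging -ge0_integralZr//; last 2 first.
- exact: measurable_averaging_integrand.
- by move=> u _; rewrite mule_ge0 ?lee_fin.
(* Translating the inner variable by [v] turns [q (u - v)] into the weight [q u] of an averaging at
   [v]. *)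
rewrite -(@ge0_integral_shift _ (fun u => g u * ((q (u - v))%:E * c v)) v).
- by apply: eq_integral => u _; rewrite addrK muleA (addrC v).
- apply: emeasurable_funM => //; apply: emeasurable_funM => //.
  apply/measurable_EFinP/(measurableT_comp mq).
  exact: measurable_funB.
- by move=> u; rewrite !mule_ge0 ?lee_fin.
Qed.

End iterates.

(** The one-step comparison is assumed for [g] alone. Commutation makes this enough: the replaced
    factor [s] moves outside the remaining factors [p], so no regularity of the intermediate
    functions is ever required. *)
Lemma iter_averaging_cmp p s g (c : R) n :
  measurable_fun [set: R] p -> measurable_fun [set: R] s ->
  (forall v, 0 <= p v)%R -> (forall v, 0 <= s v)%R ->
  \int[mu]_v (p v)%:E = 1 -> \int[mu]_v (s v)%:E = 1 ->
  measurable_fun [set: R] g -> (forall x, 0 <= g x) -> (0 <= c)%R ->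
  (forall x, averaging p g x <= averaging s g x + c%:E) ->
  forall x, iter n (averaging p) g x <= iter n (averaging s) g x + (c *+ n)%:E.
Proof.
move=> mp ms p0 s0 p1 s1 mg g0 c0 pg_sg; elim: n => [|n IH] x.
  by rewrite mulr0n adde0.
have [mp' p0'] := measurable_iter_averaging mp p0 n mg g0.
have [ms' s0'] := measurable_iter_averaging ms s0 n mg g0.
have msg := measurable_averaging ms mg s0 g0.
have sg0 := averaging_ge0 s0 g0.
have mpg := measurable_averaging mp mg p0 g0.
have pg0 := averaging_ge0 p0 g0.
have step1 : iter n.+1 (averaging p) g x <=
    iter n (averaging p) (fun y => averaging s g y + c%:E) x.
  rewrite iterSr; apply: iter_averaging_le => //.
  exact: emeasurable_funD.
apply: (le_trans step1).
have := @iter_averaging_addr p mp p0 n (averaging s g) c msg sg0 p1 c0.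
move=> /(congr1 (fun f => f x)) /= ->.
have := @iter_averagingC p mp p0 n s g ms s0 mg g0.
move=> /(congr1 (fun f => f x)) /= ->.
have step2 : averaging s (iter n (averaging p) g) x <=
    averaging s (fun y => iter n (averaging s) g y + (c *+ n)%:E) x.
  by apply: averaging_le => //; exact: emeasurable_funD.
rewrite averaging_addr ?mulrn_wge0// in step2.
rewrite -/(averaging s (iter n (averaging s) g) x).
move: step2.
move: (averaging s (iter n (averaging p) g) x) => X.
move: (averaging s (iter n (averaging s) g) x) => Y XY.
by rewrite mulrSr EFinD addeA; exact: leeD2r.
Qed.

End averaging_operator.

(** * Replacing a density by its even part *)

Section even_odd_parts.
Context {R : realType}.
Local Notation mu := (@lebesgue_measure R).
Variable p : R -> R.
Hypothesis mp : measurable_fun [set: R] p.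
Hypothesis p0 : forall v, 0 <= p v.
Hypothesis p1 : (\int[mu]_v (p v)%:E = 1)%E.

Let mpN : measurable_fun [set: R] (fun u => p (- u)).
Proof. exact: (measurableT_comp mp). Qed.

Lemma measurable_even_part : measurable_fun [set: R] (even_part p).
Proof. by apply: measurable_funM => //; exact: measurable_funD. Qed.

Lemma measurable_odd_part : measurable_fun [set: R] (odd_part p).
Proof. by apply: measurable_funM => //; exact: measurable_funB. Qed.

Lemma even_part_ge0 v : 0 <= even_part p v.
Proof. by rewrite divr_ge0// addr_ge0. Qed.

Lemma even_partN v : even_part p (- v) = even_part p v.
Proof. by rewrite /even_part opprK addrC. Qed.

Lemma even_odd_partD v : p v = even_part p v + odd_part p v.
Proof. by rewrite /even_part /odd_part; field. Qed.

Local Open Scope ereal_scope.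

Lemma integral_even_part : \int[mu]_v (even_part p v)%:E = 1.
Proof.
rewrite /even_part; under eq_integral do rewrite EFinM EFinD.
rewrite ge0_integralZr//=; last 2 first.
- by apply: emeasurable_funD; exact/measurable_EFinP.
- by move=> v _; rewrite adde_ge0 ?lee_fin.
rewrite ge0_integralD//=; last 4 first.
- by move=> v _; rewrite lee_fin.
- exact/measurable_EFinP.
- by move=> v _; rewrite lee_fin.
- exact/measurable_EFinP.
rewrite (@ge0_integral_opp _ (EFin \o p))//=; last exact/measurable_EFinP.
by rewrite p1 -EFinD -EFinM divff.
Qed.

Let ip : mu.-integrable [set: R] (EFin \o p).
Proof.
apply/integrableP; split; first exact/measurable_EFinP.
under eq_integral do rewrite /= ger0_norm//.
by rewrite p1 ltry.
Qed.

Let ies : mu.-integrable [set: R] (EFin \o even_part p).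
Proof.
apply/integrableP; split; first by apply/measurable_EFinP; exact: measurable_even_part.
under eq_integral do rewrite /= ger0_norm ?even_part_ge0//.
by rewrite integral_even_part ltry.
Qed.

Let oddE : odd_part p = (p \- even_part p)%R.
Proof. by apply/funext => v /=; rewrite /even_part /odd_part; field. Qed.

Let ir : mu.-integrable [set: R] (EFin \o odd_part p).
Proof.
rewrite oddE (_ : EFin \o _ = (EFin \o p) \- (EFin \o even_part p)).
  exact: integrableB.
by [].
Qed.

Let int_r : \int[mu]_v (odd_part p v)%:E = 0.
Proof.
rewrite oddE; under eq_integral do rewrite /= EFinB.
by rewrite (integralB measurableT ip ies) /= p1 integral_even_part subee.
Qed.

Variables (M K b : R) (g : R -> R).
Hypothesis int_ur : \int[mu]_u (u * odd_part p u)%:E = 0.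
Hypothesis int_u2r : \int[mu]_u (u ^+ 2 * `|odd_part p u|)%:E <= M%:E.
Hypothesis K0 : (0 <= K)%R.
Hypothesis mg : measurable_fun [set: R] g.
Hypothesis g0 : forall x, (0 <= g x)%R.
Hypothesis gb : forall x, (g x <= b)%R.
Hypothesis gK : forall x, exists a : R, forall h,
  (`|g (x + h) - g x - h * a| <= K * h ^+ 2)%R.

Let mu2r : measurable_fun [set: R] (fun u => u ^+ 2 * `|odd_part p u|)%R.
Proof.
apply: measurable_funM => //.
by apply: (measurableT_comp (@normr_measurable R setT)); exact: measurable_odd_part.
Qed.

Let iu2r : mu.-integrable [set: R] (fun u => (u ^+ 2 * `|odd_part p u|)%:E).
Proof.
apply/integrableP; split; first exact/measurable_EFinP.
apply: le_lt_trans (le_lt_trans int_u2r (ltry _)).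
rewrite le_eqVlt; apply/orP; left; apply/eqP.
by apply: eq_integral => u _; rewrite /= ger0_norm// mulr_ge0 ?sqr_ge0.
Qed.

Let iur : mu.-integrable [set: R] (fun u => (u * odd_part p u)%:E).
Proof.
(* The majorant comes from [|u| <= u ^ 2 + 1]. *)
apply: (@le_integrable _ _ _ mu _ measurableT _ (fun u => (u ^+ 2 * `|odd_part p u|)%:E +
   `|(odd_part p u)%:E|)).
- apply/measurable_EFinP/measurable_funM => //; exact: measurable_odd_part.
- move=> u _ /=; rewrite lee_fin.
  rewrite [leRHS]ger0_norm; last by rewrite addr_ge0// mulr_ge0// sqr_ge0.
  rewrite normrM -[X in (_ <= _ + X)%R]mul1r -mulrDl ler_wpM2r//.
  have := sqr_ge0 (`|u| - 1)%R; rewrite sqrrB1 real_normK ?num_real// => H.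
  have := normr_ge0 u; nra.
- exact: (integrableD measurableT iu2r (integrable_abse ir)).
Qed.

(* The difference of the two averages is the integral of [g (x + v)] against the
   odd part, which kills affine functions of [v]. *)
Lemma averaging_even_part_cmp x :
  averaging p (EFin \o g) x <=
  averaging (even_part p) (EFin \o g) x + (K * M)%:E.
Proof.
have [a ga] := gK x.
(* The boundedness of [g] enters here: some of the terms below have no sign, so splitting their
   integral requires integrability. *)
have igs : mu.-integrable [set: R] (fun v => (g (x + v) * even_part p v)%:E).
  apply: (@le_integrable _ _ _ mu _ measurableT _ (fun u => b%:E * (even_part p u)%:E)).
  - apply/measurable_EFinP/measurable_funM; last exact: measurable_even_part.
    by apply: (measurableT_comp mg); exact: measurable_funD.
  - have b0 : (0 <= b)%R by exact: le_trans (gb 0).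
    move=> u _ /=; rewrite lee_fin.
    rewrite (ger0_norm (mulr_ge0 (g0 _) (even_part_ge0 _))).
    rewrite (ger0_norm (mulr_ge0 b0 (even_part_ge0 _))).
    by rewrite ler_wpM2r ?even_part_ge0.
  - exact: (integrableZl measurableT _ ies).
have step : averaging p (EFin \o g) x <= \int[mu]_v
   ((g (x + v) * even_part p v)%:E + ((g x)%:E * (odd_part p v)%:E +
   (a%:E * (v * odd_part p v)%:E + K%:E * (v ^+ 2 * `|odd_part p v|)%:E))).
  apply: ge0_le_integral => //=.
  - by move=> v _; rewrite lee_fin mulr_ge0.
  - by apply: (@measurable_averaging_integrand _ p (EFin \o g)) => //;
      exact/measurable_EFinP.
  - by do ?[apply: emeasurable_funD]; do ?[apply: emeasurable_funM] => //;
     do ?[exact: measurable_int igs|exact: measurable_int ir|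
          exact: measurable_int iur|exact: measurable_int iu2r].
  - move=> v _; rewrite -!EFinM -!EFinD lee_fin.
    rewrite even_odd_partD mulrDr lerD2l.
    have : ((g (x + v) - g x - v * a) * odd_part p v <=
        K * v ^+ 2 * `|odd_part p v|)%R.
      by apply: (le_trans (ler_norm _)); rewrite normrM ler_wpM2r.
    by move: (odd_part p v) => r H; lra.
apply: (le_trans step).
have iZ c f : mu.-integrable [set: R] (EFin \o f) ->
  mu.-integrable [set: R] (fun v => c%:E * (f v)%:E).
  by move=> ?; exact: integrableZl.
have i2 := iZ a _ iur; have i3 := iZ K _ iu2r; have i1 := iZ (g x) _ ir.
have i23 := integrableD measurableT i2 i3.
rewrite integralD//; last exact: (integrableD measurableT i1 i23).
rewrite integralD// integralD//.
rewrite (integralZl measurableT ir) int_r mule0 add0e.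
rewrite (integralZl measurableT iur) int_ur mule0 add0e.
rewrite (integralZl measurableT iu2r).
rewrite leeD2l// EFinM lee_pmul//; rewrite ?lee_fin//.
by apply: integral_ge0 => v _; rewrite lee_fin mulr_ge0 ?sqr_ge0.
Qed.

(** There are [n] exchanges at cost [K M] each; the symmetric side is written as an integral so that
    a bound on [s^{*n}] can be inserted. *)
Lemma iter_averaging_even_part_cmp n : (0 < n)%N ->
  iter n (averaging p) (EFin \o g) 0%R <=
  \int[mu]_v ((g v)%:E * convolution_pow (EFin \o even_part p) n v)
  + (K * M *+ n)%:E.
Proof.
move=> n0.
rewrite (@integral_convolution_pow _ _ measurable_even_part even_part_ge0 n
  (EFin \o g) n0); last 2 first.
- exact/measurable_EFinP.
- by move=> x; rewrite lee_fin.
apply: iter_averaging_cmp => //.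
- exact: measurable_even_part.
- exact: even_part_ge0.
- exact: integral_even_part.
- exact/measurable_EFinP.
- have M0 : (0 <= M)%R.
    rewrite -lee_fin; apply: le_trans int_u2r.
    by apply: integral_ge0 => v _; rewrite lee_fin mulr_ge0 ?sqr_ge0.
  exact: mulr_ge0.
- exact: averaging_even_part_cmp.
Qed.

End even_odd_parts.

(** * Test functions with quadratic Taylor remainder *)

Section quadratic_remainder.
Context {R : realType}.
Implicit Types (g : R -> R) (K u h : R).

(** Stands in for a bound [2 K] on the second derivative, which [bump] does not have everywhere:
    squaring a positive part makes only the first derivative continuous. *)
Definition quadratic_remainder K g := forall x, exists a : R, forall h,
  `|g (x + h) - g x - h * a| <= K * h ^+ 2.

Lemma quadratic_remainder_affine K g c e : quadratic_remainder K g ->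
  quadratic_remainder (K * c ^+ 2) (fun x => g (c * x + e)).
Proof.
move=> gK x; have [a ga] := gK (c * x + e); exists (c * a) => h.
have := ga (c * h).
rewrite (_ : c * x + e + c * h = c * (x + h) + e); last by ring.
by rewrite exprMn !mulrA (mulrC h).
Qed.

Lemma quadratic_remainderD K1 K2 g1 g2 : quadratic_remainder K1 g1 ->
  quadratic_remainder K2 g2 ->
  quadratic_remainder (K1 + K2) (fun x => g1 x + g2 x).
Proof.
move=> gK1 gK2 x; have [a1 ga1] := gK1 x; have [a2 ga2] := gK2 x.
exists (a1 + a2) => h.
rewrite (_ : g1 (x + h) + g2 (x + h) - (g1 x + g2 x) - h * (a1 + a2) =
  (g1 (x + h) - g1 x - h * a1) + (g2 (x + h) - g2 x - h * a2)); last by ring.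
by apply: (le_trans (ler_normD _ _)); rewrite mulrDl lerD.
Qed.

Lemma quadratic_remainderB K g c : quadratic_remainder K g ->
  quadratic_remainder K (fun x => c - g x).
Proof.
move=> gK x; have [a ga] := gK x; exists (- a) => h.
rewrite -normrN; have := ga h.
rewrite (_ : - (c - g (x + h) - (c - g x) - h * - a) = g (x + h) - g x - h * a)//.
by ring.
Qed.

(* Vanishes for |u| <= 1/2 and is at least 1 for |u| >= 1, since
   u^2 / (1 + u^2) is then at most 1/5, respectively at least 1/2. *)
Definition bump u : R := 100 / 9 * (Num.max 0 (u ^+ 2 / (1 + u ^+ 2) - 1 / 5)) ^+ 2.

Lemma bump_ge0 u : 0 <= bump u.
Proof. by rewrite mulr_ge0 ?sqr_ge0// divr_ge0. Qed.

Let wE u : u ^+ 2 / (1 + u ^+ 2) = 1 - (1 + u ^+ 2)^-1.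
Proof.
have u1 : 1 + u ^+ 2 != 0 by rewrite gt_eqF// ltr_pwDl// sqr_ge0.
by field.
Qed.

(** The positive part stays below 4/5, and 100/9 * (4/5)^2 = 64/9. *)
Lemma bump_le8 u : bump u <= 8.
Proof.
rewrite /bump wE.
have v0 : 0 < (1 + u ^+ 2)^-1 by rewrite invr_gt0 ltr_pwDl// sqr_ge0.
set v := (1 + u ^+ 2)^-1 in v0 *.
have : 0 <= Num.max 0 (1 - v - 1 / 5) <= 4 / 5.
  by rewrite le_max lexx/= ge_max; apply/andP; split; lra.
move: (Num.max _ _) => m /andP[m0 m1].
have : m ^+ 2 <= (4 / 5) ^+ 2 by rewrite ler_sqr ?nnegrE//; lra.
lra.
Qed.

(** Origin of the factor 100/9: it is the inverse square of 1/2 - 1/5 = 3/10. *)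
Lemma bump_ge1 u : 1 <= `|u| -> 1 <= bump u.
Proof.
move=> u1; rewrite /bump wE.
have u2 : 1 <= u ^+ 2 by rewrite -real_normK ?num_real// exprn_ege1.
have v2 : (1 + u ^+ 2)^-1 <= 1 / 2.
  by rewrite div1r lef_pV2 ?posrE//; lra.
set v := (1 + u ^+ 2)^-1 in v2 *.
have : 3 / 10 <= Num.max 0 (1 - v - 1 / 5).
  by rewrite le_max; apply/orP; right; lra.
move: (Num.max _ _) => m m1.
have : (3 / 10) ^+ 2 <= m ^+ 2 by rewrite ler_sqr ?nnegrE//; lra.
lra.
Qed.

Lemma bump_eq0 u : `|u| <= 1 / 2 -> bump u = 0.
Proof.
move=> u1; rewrite /bump wE.
have u2 : u ^+ 2 <= 1 / 4.
  rewrite -real_normK ?num_real//.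
  rewrite (_ : 1 / 4 = (1 / 2) ^+ 2); last by field.
  by rewrite ler_sqr ?nnegrE.
have v2 : 4 / 5 <= (1 + u ^+ 2)^-1.
  rewrite (_ : 4 / 5 = (5 / 4)^-1); last by rewrite invf_div.
  by have H := sqr_ge0 u; rewrite lef_pV2 ?posrE; lra.
set v := (1 + u ^+ 2)^-1 in v2 *.
have /max_idPl -> : 1 - v - 1 / 5 <= 0 by lra.
by rewrite expr0n/= mulr0.
Qed.

Lemma measurable_bump : measurable_fun [set: R] bump.
Proof.
apply: measurable_funM => //; apply: measurable_funX.
apply: measurable_maxr => //; apply: measurable_funB => //.
under eq_fun do rewrite wE.
apply: measurable_funB => //.
apply: continuous_measurable_fun => u.
apply: cvgV.
  by rewrite gt_eqF// ltr_pwDl// sqr_ge0.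
by apply: cvgD; [exact: cvg_cst|exact: exprn_continuous].
Qed.

(** The squared positive part has derivative [2 max(0, x)], which is 2-Lipschitz. When [x] and [y]
    have opposite signs, [x y <= 0] is what closes the inequality. *)
Lemma posp_sqr_remainder (x y : R) :
  `|Num.max 0 y ^+ 2 - Num.max 0 x ^+ 2 - (y - x) * (2 * Num.max 0 x)|
  <= (y - x) ^+ 2.
Proof.
rewrite ler_norml; case: (leP 0 x) => x0; case: (leP 0 y) => y0; apply/andP.
- by have := sqr_ge0 (y - x); split; lra.
- have : x * y <= 0 by rewrite mulr_ge0_le0// ltW.
  by have := sqr_ge0 x; have := sqr_ge0 y; have := sqr_ge0 (y - x); split; lra.
- have : x * y <= 0 by rewrite mulr_le0_ge0// ltW.
  by have := sqr_ge0 x; have := sqr_ge0 y; have := sqr_ge0 (y - x); split; lra.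
- by have := sqr_ge0 (y - x); split; lra.
Qed.

(** Chain rule with remainders. The inner function [1 - v] is 1-Lipschitz with derivative [2 u v^2]
    and remainder at most [2 h^2]; the outer one is a squared positive part, with slope [2 m] and
    [m <= 4/5]. In total 100/9 * (1 + 2 * (4/5) * 2) = 140/3, which is below 50. *)
Lemma bump_quadratic_remainder : quadratic_remainder 50 bump.
Proof.
move=> u; pose v := (1 + u ^+ 2)^-1; pose m := Num.max 0 (1 - v - 1 / 5).
exists (100 / 9 * (2 * m * (2 * u * v ^+ 2))) => h.
rewrite /bump !wE -/v -/m; set v' := (1 + (u + h) ^+ 2)^-1.
set m' := Num.max _ _.
have p1 : 0 < 1 + u ^+ 2 by rewrite ltr_pwDl// sqr_ge0.
have p2 : 0 < 1 + (u + h) ^+ 2 by rewrite ltr_pwDl// sqr_ge0.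
have v0 : 0 < v <= 1.
  by rewrite invr_gt0 p1/= invf_le1// lerDl sqr_ge0.
have v'0 : 0 < v' <= 1.
  by rewrite invr_gt0 p2/= invf_le1// lerDl sqr_ge0.
(* Both are of the form [x / (1 + x^2)], hence at most 1/2 in absolute value, and the increment and
   remainder of [v] are polynomials in [X], [Y], [v], [v'] and [h]. *)
pose X := u * v; pose Y := (u + h) * v'.
have half (x : R) : `|x * (1 + x ^+ 2)^-1| <= 1 / 2.
  have q : 0 < 1 + x ^+ 2 by rewrite ltr_pwDl// sqr_ge0.
  rewrite normrM (gtr0_norm (x := _^-1)) ?invr_gt0// ler_pdivrMr//.
  have := sqr_ge0 (`|x| - 1); rewrite sqrrB1 real_normK ?num_real//; lra.
have /ler_normlP[X1 X2] : `|X| <= 1 / 2 by exact: half.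
have /ler_normlP[Y1 Y2] : `|Y| <= 1 / 2 by exact: half.
have dv : v - v' = h * (X * v' + Y * v).
  by rewrite /X /Y /v' /v; field; rewrite !gt_eqF.
have E1 : v - v' - h * (2 * u * v ^+ 2) =
    h ^+ 2 * (v * v' - 2 * X * (X * v' + Y * v)).
  by rewrite /X /Y /v' /v; field; rewrite !gt_eqF.
case/andP: v0 => v0 v1; case/andP: v'0 => v'0 v'1.
have XY : `|X * v' + Y * v| <= 1 by rewrite ler_norml; apply/andP; split; nra.
have dv1 : `|v - v'| <= `|h|.
  by rewrite dv normrM ler_piMr.
have E2 : `|v - v' - h * (2 * u * v ^+ 2)| <= 2 * h ^+ 2.
  rewrite E1 normrM ger0_norm ?sqr_ge0// mulrC ler_wpM2r ?sqr_ge0//.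
  move: XY; rewrite !ler_norml => /andP[XY1 XY2].
  move: (X * v' + Y * v) XY1 XY2 => Z Z1 Z2.
  have vv1 : 0 < v * v' by exact: mulr_gt0.
  have vv2 : v * v' <= 1 by rewrite mulr_ile1// ltW.
  by apply/andP; split; nra.
have m0 : 0 <= m <= 4 / 5.
  by rewrite le_max lexx/= ge_max; apply/andP; split; lra.
have mm : `|m' ^+ 2 - m ^+ 2 - (v - v') * (2 * m)| <= (v - v') ^+ 2.
  rewrite /m' /m (_ : v - v' = (1 - v' - 1 / 5) - (1 - v - 1 / 5)); last by ring.
  exact: posp_sqr_remainder.
have h2 : (v - v') ^+ 2 <= h ^+ 2.
  by rewrite -[leLHS]real_normK ?num_real// -[leRHS]real_normK ?num_real// ler_sqr ?nnegrE.
rewrite (_ : _ - _ - _ = 100 / 9 * ((m' ^+ 2 - m ^+ 2 - (v - v') * (2 * m)) +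
  2 * m * (v - v' - h * (2 * u * v ^+ 2)))); last by ring.
rewrite normrM ger0_norm; last by rewrite divr_ge0.
apply: (@le_trans _ _ (100 / 9 * (h ^+ 2 + 2 * m * (2 * h ^+ 2)))).
  rewrite ler_wpM2l//.
  apply: (le_trans (ler_normD _ _)); apply: lerD; first exact: le_trans mm h2.
  have /andP[m1 m2] := m0.
  rewrite normrM (ger0_norm (x := 2 * m)) ?mulr_ge0//.
  by rewrite ler_wpM2l// mulr_ge0.
by have := sqr_ge0 h; move: m0 => /andP[? ?]; nra.
Qed.

End quadratic_remainder.

(** * Power and Gaussian tails *)

Section power_tail.
Context {R : realType}.
Local Notation mu := (@lebesgue_measure R).
Implicit Types (a b : R).

Lemma integral_powR_tail a b : 0 < a -> 1 <= b ->
  (\int[mu]_(u in `[a, +oo[) (u `^ (- (1 + b)))%:E = (a `^ (- b) / b)%:E)%E.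
Proof.
move=> a0 b1; have b0 : 0 < b by exact: lt_le_trans b1.
pose F := fun u : R => - b^-1 * u `^ (- b).
have dF (x : R) : 0 < x -> is_derive x 1 F (x `^ (- (1 + b))).
  move=> x0; have H := is_derive1_powR (- b) x0.
  apply: is_derive_eq.
  rewrite /GRing.scale/= mulrA mulrNN mulVf ?gt_eqF// mul1r.
  by rewrite -opprD addrC.
have cf (x : R) : 0 < x -> {for x, continuous (fun u : R => u `^ (- (1 + b)))}.
  move=> x0; apply: differentiable_continuous; apply/derivable1_diffP.
  by have [] := is_derive1_powR (- (1 + b)) x0.
rewrite (@ge0_continuous_FTC2y _ _ F a 0).
- by rewrite -EFinB sub0r /F mulNr opprK mulrC.
- by move=> x _; exact: powR_ge0.
- apply: continuous_in_subspaceT => x; rewrite inE/= in_itv/= andbT => ax.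
  by apply: cf; exact: lt_le_trans ax.
- rewrite -(mulr0 (- b^-1)); apply: cvgM; first exact: cvg_cst.
  (* Since [1 <= b], the power is below [1 / x] as soon as [x >= 1]. *)
  apply: (@squeeze_cvgr _ _ _ _ (fun=> 0) (fun x => x^-1)).
  + near=> x; have x1 : 1 <= x by near: x; exact: nbhs_pinfty_ge.
    rewrite powR_ge0/= -powR_inv1 ?(le_trans ler01)//.
    by apply: ler_powR => //; rewrite lerN2.
  + exact: cvg_cst.
  + apply/gtr0_cvgV0; last exact: cvg_id.
    by near=> x; near: x; exact: nbhs_pinfty_gt.
- by move=> x ax; have [] := dF _ (lt_trans a0 ax).
- apply: cvg_at_right_filter.
  apply: differentiable_continuous; apply/derivable1_diffP.
  by have [] := dF _ a0.
- move=> x; rewrite in_itv/= andbT => ax.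
  by rewrite derive1E; have [_] := dF _ (lt_trans a0 ax).
Unshelve. all: by end_near. Qed.

(** The majorant is a power supported on [[a, +oo[] plus its reflection, whence the factor 2. *)
Lemma integral_sym_tail_le (f : R -> \bar R) (A : R) a b :
  0 < a -> 1 <= b -> 0 <= A ->
  measurable_fun [set: R] f -> (forall u, (0 <= f u)%E) ->
  (forall u, `|u| < a -> f u = 0%E) ->
  (forall u, a <= `|u| -> (f u <= (A * `|u| `^ (- (1 + b)))%:E)%E) ->
  (\int[mu]_u f u <= (2 * (A * (a `^ (- b) / b)))%:E)%E.
Proof.
move=> a0 b1 A0 mf f0 f_eq0 f_le.
pose h (u : R) : \bar R :=
  (A%:E * ((fun u : R => (u `^ (- (1 + b)))%:E) \_ `[a, +oo[) u)%E.
have h0 u : (0 <= h u)%E.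
  rewrite /h patchE; case: ifP => _; last by rewrite mule0.
  by rewrite mule_ge0 ?lee_fin// powR_ge0.
have mpow : measurable_fun [set: R] (fun u : R => (u `^ (- (1 + b)))%:E).
  by apply/measurable_EFinP; exact: measurable_powR.
have mh : measurable_fun [set: R] h.
  apply: emeasurable_funM => //.
  by apply/(measurable_restrictT _ _).1 => //; exact: measurable_funTS.
have mhN : measurable_fun [set: R] (fun u => h (- u)).
  exact: (measurableT_comp mh).
have -> : (2 * (A * (a `^ (- b) / b)))%:E = (\int[mu]_u (h u + h (- u)%R))%E.
  rewrite ge0_integralD//= ge0_integral_opp//.
  rewrite /h ge0_integralZl//=; last 2 first.
  - by apply/(measurable_restrictT _ _).1 => //; exact: measurable_funTS.
  - by move=> u _; apply: erestrict_ge0 => v _; rewrite lee_fin powR_ge0.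
  rewrite -integral_mkcond integral_powR_tail// -EFinM -EFinD.
  by congr EFin; ring.
apply: ge0_le_integral => //.
- by apply: emeasurable_funD.
move=> u _; have [ua|au] := ltP `|u| a.
  by rewrite f_eq0// adde_ge0.
apply: (le_trans (f_le _ au)); rewrite /h !patchE.
have [u0|u0] := leP 0 u.
  rewrite ger0_norm// in au *.
  rewrite ifT; last by rewrite inE/= in_itv/= au.
  rewrite -EFinM leeDl// mule_ge0 ?lee_fin//; case: ifP => _ //.
  by rewrite lee_fin powR_ge0.
rewrite ltr0_norm// in au *.
rewrite addeC ifT; last by rewrite inE/= in_itv/= au.
rewrite -EFinM leeDl// mule_ge0 ?lee_fin//; case: ifP => _ //.
by rewrite lee_fin powR_ge0.
Qed.

End power_tail.

(** * The upper tail of the standard Gaussian law *)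

Section gaussian.
Context {R : realType}.
Local Notation mu := (@lebesgue_measure R).
Local Notation pdf := (normal_pdf 0 1 : R -> R).
Local Notation gauss := (normal_prob (0 : R) 1).

Let peak_le1 : normal_peak (1 : R) <= 1.
Proof.
rewrite /normal_peak expr1n mul1r invf_le1; last first.
  by rewrite sqrtr_gt0 mulrn_wgt0// pi_gt0.
rewrite -[leLHS]sqrtr1 ler_sqrt; last by rewrite mulrn_wge0// pi_ge0.
have := pi_ge2 R; rewrite -mulr_natr; lra.
Qed.

Let pdfE (x : R) : pdf x = normal_peak 1 * expR (- (x ^+ 2 / 2)).
Proof.
rewrite normal_pdfE ?oner_eq0// /normal_fun subr0 expr1n.
by rewrite mulNr.
Qed.

Lemma normal_pdfN (x : R) : pdf (- x) = pdf x.
Proof. by rewrite !pdfE sqrrN. Qed.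

(** For [0 <= x <= y], factor out [e = expR (- x^2 / 2)] and use [expR (- t) >= 1 - t]; the linear
    part of [e t] is controlled by [x e <= 1]. *)
Lemma expRN_sqr_lipschitz (x y : R) :
  `|expR (- (x ^+ 2 / 2)) - expR (- (y ^+ 2 / 2))| <= 2 * `|x - y|.
Proof.
wlog xy : x y / `|x| <= `|y|.
  move=> H; have [xy|/ltW yx] := leP `|x| `|y|; first exact: H.
  by rewrite distrC (distrC x); exact: H.
rewrite -(real_normK (num_real x)) -(real_normK (num_real y)).
have : `|y| - `|x| <= `|x - y| by rewrite distrC lerB_dist.
move: (normr_ge0 x) xy => + +; move: `|x| `|y| `|x - y| => {}x {}y d x0 xy dxy.
have e0 := expR_ge0 (- (x ^+ 2 / 2)).
have e1 : expR (- (x ^+ 2 / 2)) <= 1.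
  by rewrite -[leRHS]expR0 ler_expR; have := sqr_ge0 x; lra.
have exy : expR (- (y ^+ 2 / 2)) <= expR (- (x ^+ 2 / 2)).
  have y0 := le_trans x0 xy.
  by rewrite ler_expR lerN2 ler_pM2r// ler_sqr ?nnegrE.
rewrite ger0_norm ?subr_ge0//.
apply: (@le_trans _ _ (2 * (y - x))); last by lra.
(* Both values lie in [0, 1], so a long increment needs no estimate; for a short one the square
   [(y - x)^2] is at most [y - x]. *)
have [d1|d1] := leP 1 (y - x); first by have := expR_ge0 (- (y ^+ 2 / 2)); lra.
have -> : - (y ^+ 2 / 2) = - (x ^+ 2 / 2) + - ((y - x) * x + (y - x) ^+ 2 / 2) by field.
rewrite expRD.
set t := (y - x) * x + (y - x) ^+ 2 / 2.
have et : 1 - t <= expR (- t) by exact: expR_ge1Dx.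
have xe : x * expR (- (x ^+ 2 / 2)) <= 1.
  rewrite expRN ler_pdivrMr ?expR_gt0// mul1r.
  apply: (le_trans _ (expR_ge1Dx _)).
  by have := sqr_ge0 (x - 1); nra.
have tE : expR (- (x ^+ 2 / 2)) * t <= 2 * (y - x).
  rewrite /t; move: e0 e1 xe; move: (expR (- (x ^+ 2 / 2))) => e e0 e1 xe.
  have p1 : (y - x) * (x * e) <= (y - x) * 1 by apply: ler_wpM2l => //; lra.
  have p2 : (y - x) ^+ 2 * e <= (y - x) ^+ 2 by rewrite ler_piMr ?sqr_ge0.
  have p3 : (y - x) ^+ 2 <= y - x by nra.
  lra.
by move: et tE; move: (expR (- t)) => et' et tE; nra.
Qed.

Lemma normal_pdf_lipschitz (x y : R) : `|pdf x - pdf y| <= 2 * `|x - y|.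
Proof.
rewrite !pdfE -mulrBr normrM ger0_norm ?normal_peak_ge0//.
apply: le_trans (expRN_sqr_lipschitz x y).
by rewrite ler_piMl.
Qed.

Lemma normal_probN (A : set R) : measurable A -> gauss (-%R @^-1` A) = gauss A.
Proof.
move=> mA; rewrite /normal_prob [LHS]integral_mkcond [RHS]integral_mkcond.
rewrite -[RHS]ge0_integral_opp; last 2 first.
- apply/(measurable_restrictT _ _).1 => //; apply/measurable_EFinP.
  by apply: measurable_funTS; exact: measurable_normal_pdf.
- by move=> u; apply: erestrict_ge0 => v _; rewrite lee_fin normal_pdf_ge0.
apply: eq_integral => u _; rewrite !patchE normal_pdfN.
by congr (if _ then _ else _); apply/idP/idP; rewrite !inE.
Qed.

Definition normal_tail (z : R) : R := fine (gauss `]z, +oo[%classic).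

Lemma normal_tailE z : gauss `]z, +oo[%classic = (normal_tail z)%:E.
Proof. by rewrite fineK// fin_num_measure. Qed.

Lemma normal_tail_ge0 z : 0 <= normal_tail z.
Proof. by rewrite -lee_fin -normal_tailE measure_ge0. Qed.

Lemma normal_probNy z : gauss `]-oo, z[%classic = (normal_tail (- z))%:E.
Proof.
rewrite -normal_tailE -normal_probN//; congr (gauss _).
by apply/seteqP; split => u /=; rewrite !in_itv/= andbT ltrNl.
Qed.

(** The law has no atoms. Hence open and closed half-lines share one tail function, which makes
    complements of half-lines harmless later. *)
Lemma normal_tail_cy z : gauss `[z, +oo[%classic = (normal_tail z)%:E.
Proof.
rewrite -normal_tailE /normal_prob integral_itv_obnd_cbnd//.
apply/measurable_EFinP.
by apply: measurable_funTS; exact: measurable_normal_pdf.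
Qed.

Lemma normal_tailN z : normal_tail z + normal_tail (- z) = 1.
Proof.
apply: EFin_inj; rewrite EFinD -(normal_probNy z) -(normal_tail_cy z).
rewrite -(@probability_setT _ _ _ gauss) -measureU//.
  by congr (gauss _); rewrite setUC -setCitvl setUv.
by apply/seteqP; split => // u []/=; rewrite !in_itv/= andbT leNgt => /negP.
Qed.

Lemma normal_tail_diff (a b : R) : a <= b ->
  normal_tail a - normal_tail b = fine (gauss `]a, b]%classic) /\
  gauss `]a, b]%classic \is a fin_num.
Proof.
move=> ab; split; last by rewrite fin_num_measure.
apply: EFin_inj; rewrite fineK ?fin_num_measure// EFinB -!normal_tailE.
rewrite [in X in (X - _)%E](_ : `]a, +oo[ = `]a, b] `|` `]b, +oo[)%classic.
  rewrite measureU//= ?addeK ?fin_num_measure//.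
  apply/seteqP; split => // u []/=; rewrite !in_itv/= andbT => /andP[_].
  by rewrite leNgt => /negP.
by rewrite -itv_bndbnd_setU// bnd_simp.
Qed.

(** On []a, b]] the density differs from its value at [z] by at most [2 (b - a)]. The point [z] is
    free so that it can be the left or the right end, according to the sign of the increment. *)
Lemma normal_tail_diff_le (a b z : R) : a <= b -> a <= z <= b ->
  `|normal_tail a - normal_tail b - (b - a) * pdf z| <= 2 * (b - a) ^+ 2.
Proof.
move=> ab /andP[az zb]; have [dE fin] := normal_tail_diff ab.
have lebab c : (\int[mu]_(x in `]a, b]) c%:E = (c * (b - a))%:E)%E.
  rewrite integral_cst//= lebesgue_measure_itv/= lte_fin.
  case: ltP => [_|ba]; first by rewrite -EFinB -EFinM.
  have -> : b = a by apply/eqP; rewrite eq_le ba.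
  by rewrite subrr mule0 mulr0.
have ic c : mu.-integrable `]a, b]%classic (cst c%:E : R -> \bar R).
  apply/integrableP; split; first exact: measurable_cst.
  by rewrite /= lebab ltry.
have ip : mu.-integrable `]a, b]%classic (fun x : R => (pdf x)%:E).
  by apply: integrableS (integrable_normal_pdf 0 1).
have near_z (u : R) : `]a, b]%classic u -> `|pdf u - pdf z| <= 2 * (b - a).
  rewrite /= in_itv/= => /andP[au ub].
  apply: (le_trans (normal_pdf_lipschitz _ _)); rewrite ler_wpM2l//.
  by rewrite ler_norml; apply/andP; split; lra.
rewrite dE; set X := fine _.
have XE : X%:E = (\int[mu]_(x in `]a, b]) (pdf x)%:E)%E by rewrite fineK.
have X1 : X <= (pdf z + 2 * (b - a)) * (b - a).
  rewrite -lee_fin XE -lebab; apply: le_integral => //; first exact: ic.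
  move=> u; rewrite inE => /near_z; rewrite ler_norml lee_fin => /andP[_].
  by lra.
have X2 : (pdf z - 2 * (b - a)) * (b - a) <= X.
  rewrite -lee_fin XE -lebab; apply: le_integral => //; first exact: ic.
  move=> u; rewrite inE => /near_z; rewrite ler_norml lee_fin => /andP[+ _].
  by lra.
by rewrite ler_norml; apply/andP; split; lra.
Qed.

Lemma normal_tail_quadratic_remainder : quadratic_remainder 2 normal_tail.
Proof.
move=> z; exists (- pdf z) => h; have [h0|/ltW h0] := leP 0 h.
  have := @normal_tail_diff_le z (z + h) z; rewrite lerDl lexx h0.
  move=> /(_ isT isT); rewrite (_ : z + h - z = h); last by ring.
  by rewrite -normrN; congr (`|_| <= _); ring.
have := @normal_tail_diff_le (z + h) z z; rewrite gerDl lexx h0.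
move=> /(_ isT isT); rewrite (_ : z - (z + h) = - h) ?sqrrN; last by ring.
by congr (`|_| <= _); ring.
Qed.

Lemma nonincreasing_normal_tail : nonincreasing_fun normal_tail.
Proof.
move=> x y xy; rewrite -lee_fin -!normal_tailE le_measure ?inE//.
by move=> u /=; rewrite !in_itv/= !andbT; exact: le_lt_trans.
Qed.

Lemma measurable_normal_tail : measurable_fun [set: R] normal_tail.
Proof.
by apply: nonincreasing_measurable => //; exact: nonincreasing_normal_tail.
Qed.

(** Integrates [expR (- u^2 / 2) <= 2 / u^2]. The crude rate [1 / y] matches that of the
    heavy-tailed part, and the median amplifies both. *)
Lemma normal_tail_le (y : R) : 0 < y -> normal_tail y <= 2 / y.
Proof.
move=> y0; rewrite -lee_fin -normal_tail_cy /normal_prob.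
have -> : (2 / y)%:E = (\int[mu]_(u in `[y, +oo[) (2%:E * (u `^ (- (1 + 1)))%:E))%E.
  rewrite ge0_integralZl//=.
  - by rewrite integral_powR_tail// -EFinM divr1 powR_inv1// ltW.
  - apply/measurable_EFinP; apply: measurable_funTS; exact: measurable_powR.
  - by move=> u _; rewrite lee_fin powR_ge0.
apply: ge0_le_integral => //.
- by move=> u _; rewrite lee_fin normal_pdf_ge0.
- apply/measurable_EFinP; apply: measurable_funTS; exact: measurable_normal_pdf.
- apply/measurable_EFinP; apply: measurable_funM => //.
  by apply: measurable_funTS; exact: measurable_powR.
move=> u /=; rewrite in_itv/= andbT => yu; have u0 := lt_le_trans y0 yu.
rewrite -EFinM lee_fin powRN (_ : 1 + 1 = 2%:R) ?powR_mulrn ?(ltW u0)//.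
rewrite pdfE.
apply: (@le_trans _ _ (expR (- (u ^+ 2 / 2)))); first by rewrite ler_piMl// expR_ge0.
rewrite expRN (_ : 2 * _ = (u ^+ 2 / 2)^-1); last by rewrite invf_div.
rewrite lef_pV2 ?posrE ?expR_gt0//; last by rewrite divr_gt0// exprn_gt0.
by apply: (le_trans _ (expR_ge1Dx _)); rewrite lerDr.
Qed.

End gaussian.

(** * Independence *)

Section independence.
Context d (T : measurableType d) (R : realType) (P : probability T R).
Local Open Scope ereal_scope.

Let preimage_measurable (X : T -> R) (A : set R) :
  measurable_fun [set: T] X -> measurable A -> measurable (X @^-1` A).
Proof. by move=> mX mA; rewrite -[_ @^-1` _]setTI; exact: mX. Qed.

(** Two finite measures on the plane, the law of [(X, Y)] restricted to [E] and the same law scaled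
    by [P E], agree on rectangles, which form a generating pi-system. *)
Lemma independent_event_pair (X Y : T -> R) (E : set T) :
  measurable_fun [set: T] X -> measurable_fun [set: T] Y -> measurable E ->
  (forall A B, measurable A -> measurable B ->
    P (X @^-1` A `&` Y @^-1` B `&` E) = P (X @^-1` A `&` Y @^-1` B) * P E) ->
  forall C : set (R * R), measurable C ->
    P ((fun w => (X w, Y w)) @^-1` C `&` E) =
    P ((fun w => (X w, Y w)) @^-1` C) * P E.
Proof.
move=> mX mY mE XYE C mC.
have mXY : measurable_fun [set: T] (fun w => (X w, Y w)).
  exact: measurable_fun_pair.
pose XY w := (X w, Y w).
have PE0 : (0 <= fine (P E))%R by rewrite fine_ge0.
rewrite -/XY muleC -(fineK (fin_num_measure P E mE)).
pose G : set (set (R * R)) := [set C | exists A B : set R,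
   [/\ measurable A, measurable B & C = A `*` B]].
have := @measure_unique _ R (R * R)%type G (fun=> setT) _ _ _ _
   (pushforward (mrestr P mE) XY) (mscale (NngNum PE0) (pushforward P XY)).
move/(_ _ _ _ _ mXY mXY); apply => //.
- rewrite measurable_prod_measurableType //; congr (<<s _ >>).
  rewrite predeqE => D; split => [[A mA [B mB <-]]|[A [B [mA mB ->]]]].
    by exists A, B.
  by exists A => //; exists B.
- move=> _ _ [A1 [B1 [mA1 mB1 ->]]] [A2 [B2 [mA2 mB2 ->]]].
  exists (A1 `&` A2), (B1 `&` B2); rewrite setXI; split => //.
    exact: measurableI.
  exact: measurableI.
- by move=> _; exists setT, setT; rewrite setXTT; split.
- by rewrite -subTset => x _; exists 0%N.
- move=> _ [A [B [mA mB ->]]].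
  change (P (XY @^-1` (A `*` B) `&` E) = (fine (P E))%:E * P (XY @^-1` (A `*` B))).
  by rewrite fineK ?fin_num_measure// muleC -XYE.
- move=> _; change (P (XY @^-1` setT `&` E) < +oo).
  by rewrite (le_lt_trans (probability_le1 _ _)) ?ltry// preimage_setT setTI.
Qed.

(** The joint law is the product of the laws; Tonelli then allows [X] to be frozen while [Y] is
    averaged. *)
Lemma independent_integral (X Y : T -> R) :
  measurable_fun [set: T] X -> measurable_fun [set: T] Y ->
  (forall A B, measurable A -> measurable B ->
    P (X @^-1` A `&` Y @^-1` B) = P (X @^-1` A) * P (Y @^-1` B)) ->
  forall f : R * R -> \bar R, measurable_fun [set: R * R] f ->
  (forall z, 0 <= f z) ->
  \int[P]_w f (X w, Y w) = \int[P]_w \int[P]_w' f (X w, Y w').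
Proof.
move=> mX mY XY f mf f0.
have mXY : measurable_fun [set: T] (fun w => (X w, Y w)).
  exact: measurable_fun_pair.
pose X' : {RV P >-> R} := HB.pack X (isMeasurableFun.Build _ _ _ _ _ mX).
pose Y' : {RV P >-> R} := HB.pack Y (isMeasurableFun.Build _ _ _ _ _ mY).
pose Z : {RV P >-> (R * R)%type} :=
  HB.pack (fun w => (X w, Y w)) (isMeasurableFun.Build _ _ _ _ _ mXY).
transitivity (\int[distribution P Z]_z f z).
  by rewrite ge0_integral_distribution.
transitivity (\int[distribution P X' \x distribution P Y']_z f z).
  apply: eq_measure_integral => A mA _; apply/esym.
  exact: product_measure_unique.
rewrite fubini_tonelli1// ge0_integral_distribution//.
- apply: eq_integral => w _ /=; rewrite /fubini_F/=.
  rewrite ge0_integral_distribution//.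
  by apply: measurableT_comp => //; exact: pair1_measurable.
- exact: measurable_fun_fubini_tonelli_F.
- by move=> x; exact: integral_ge0.
Qed.

Section merging.
Variable K : finType.
Implicit Types W : K -> T -> R.

Lemma mutually_independent_pair W i j : mutually_independent P W -> i != j ->
  forall A B, measurable A -> measurable B ->
  P (W i @^-1` A `&` W j @^-1` B) = P (W i @^-1` A) * P (W j @^-1` B).
Proof.
move=> Wind ij A B mA mB.
pose C k : set R := if k == i then A else if k == j then B else setT.
have mC k : measurable (C k) by rewrite /C; do 2!case: ifP => _ //.
have := Wind C mC.
rewrite (bigD1 i)//= (bigD1 j) 1?eq_sym//= big1 ?mule1; last first.
  move=> k /andP[ki kj]; rewrite /C (negbTE ki) (negbTE kj) preimage_setT.
  exact: probability_setT.
rewrite {2 3}/C eqxx (negbTE (_ : j != i)) 1?eq_sym// eqxx => <-.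
congr (P _); apply/seteqP; split => w /=.
  by case=> Aw Bw k; rewrite /C; case: eqP => [->//|_]; case: eqP => [->|].
move=> Cw; split.
  by have := Cw i; rewrite /C eqxx.
by have := Cw j; rewrite /C eq_sym (negbTE ij) eqxx.
Qed.

(* Adds the i-th variable to the j-th one and makes the i-th one constant, hence
   independent of the others: the index type does not change. *)
Definition merge W (i j : K) (k : K) (w : T) : R :=
  if k == i then 0%R else if k == j then (W j w + W i w)%R else W k w.

Lemma measurable_merge W i j : (forall k, measurable_fun [set: T] (W k)) ->
  forall k, measurable_fun [set: T] (merge W i j k).
Proof.
move=> mW k; rewrite /merge; case: (k == i) => //; case: (k == j) => //.
exact: measurable_funD.
Qed.

(** The events of all untouched variables form a single event [E]. It is independent of the pair
    [(W j, W i)], hence of any event on the sum of the two. *)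
Lemma mutually_independent_merge W i j :
  (forall k, measurable_fun [set: T] (W k)) -> i != j ->
  mutually_independent P W -> mutually_independent P (merge W i j).
Proof.
move=> mW ij Wind A mA.
have ji : j != i by rewrite eq_sym.
pose E := [set w | forall k, k != i -> k != j -> A k (W k w)].
have mE : measurable E.
  rewrite (_ : E = \bigcap_(k in [set k | (k != i) && (k != j)]) (W k @^-1` A k)).
    apply: fin_bigcap_measurable; first exact: finite_finset.
    by move=> k _; exact: preimage_measurable.
  apply/seteqP; split => w /=.
    by move=> Ew k /= /andP[ki kj]; exact: Ew.
  by move=> Ew k ki kj; apply: Ew; rewrite /= ki kj.
pose q := \prod_(k | (k != i) && (k != j)) P (W k @^-1` A k).
have rule a b : measurable a -> measurable b ->
    P (W j @^-1` a `&` W i @^-1` b `&` E) =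
    P (W j @^-1` a) * P (W i @^-1` b) * q.
  move=> ma mb.
  pose C k : set R := if k == i then b else if k == j then a else A k.
  have mC k : measurable (C k) by rewrite /C; do 2!case: ifP => _ //.
  have := Wind C mC.
  rewrite (bigD1 i)//= (bigD1 j)//=.
  rewrite {2 3}/C eqxx (negbTE ji) eqxx => H.
  rewrite (muleC (P (W j @^-1` a))) -muleA.
  transitivity (P [set w | forall i, C i (W i w)]).
    congr (P _); apply/seteqP; split => w /=.
      case=> -[aw bw] Ew k; rewrite /C; case: eqP => [->//|/eqP ki].
      by case: eqP => [->//|/eqP kj]; exact: Ew.
    move=> Cw; split; first split.
    - by have := Cw j; rewrite /C (negbTE ji) eqxx.
    - by have := Cw i; rewrite /C eqxx.
    - by move=> k ki kj; have := Cw k; rewrite /C (negbTE ki) (negbTE kj).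
  rewrite H; congr (_ * (_ * _)).
  by apply: eq_bigr => k /andP[ki kj]; rewrite /C (negbTE ki) (negbTE kj).
have PE : P E = q.
  have := rule setT setT measurableT measurableT.
  by rewrite !preimage_setT !setTI !probability_setT !mul1e.
(* The merged variable at [i] is the constant 0, so its event is sure or empty according to whether
   [A i] contains 0. *)
have PA_E : P [set w | forall k, A k (merge W i j k w)] =
    P (merge W i j i @^-1` A i) * P (merge W i j j @^-1` A j `&` E).
  have [Ai0|Ai0] := pselect (A i 0%R).
    rewrite [X in _ = P X * _](_ : _ = setT); last first.
      by apply/seteqP; split => w //= _; rewrite /merge eqxx.
    rewrite probability_setT mul1e; congr (P _).
    apply/seteqP; split => w /=.
      move=> Aw; split; first exact: Aw.
      by move=> k ki kj; have := Aw k; rewrite /merge (negbTE ki) (negbTE kj).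
    case=> Ajw Ew k; have [->|ki] := eqVneq k i; first by rewrite /merge eqxx.
    have [->|kj] := eqVneq k j; first exact: Ajw.
    by rewrite /merge (negbTE ki) (negbTE kj); exact: Ew.
  rewrite (_ : [set w | _] = set0); last first.
    by rewrite -subset0 => w /= /(_ i); rewrite /merge eqxx.
  rewrite [X in _ = P X * _](_ : _ = set0) ?measure0 ?mul0e//.
  by rewrite -subset0 => w /=; rewrite /merge eqxx.
rewrite PA_E (bigD1 i)//= (bigD1 j)//=; congr (_ * _).
have -> : \prod_(k | (k != i) && (k != j)) P (merge W i j k @^-1` A k) = q.
  apply: eq_bigr => k /andP[ki kj]; congr (P _).
  by apply/seteqP; split => w /=; rewrite /merge (negbTE ki) (negbTE kj).
have -> : merge W i j j @^-1` A j =
    (fun w => (W j w, W i w)) @^-1` [set z | A j (z.1 + z.2)%R].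
  by apply/seteqP; split => w /=; rewrite /merge (negbTE ji) eqxx.
rewrite -PE; apply: independent_event_pair => //.
- move=> a b ma mb; rewrite rule// PE; congr (_ * _).
  by rewrite -(mutually_independent_pair Wind).
- have := @measurable_funD _ (R * R)%type R setT fst snd
    measurable_fst measurable_snd.
  by move=> /(_ measurableT _ (mA j)); rewrite setTI.
Qed.

Section merge_seq.
Variable c : K -> K.

(** [c i] is the index that receives the [i]-th variable. *)
Definition merge_seq W (r : seq K) : K -> T -> R :=
  foldl (fun W i => merge W i (c i)) W r.

(** No receiving index is itself merged away, so every variable of [r] moves exactly once and the
    order of [r] is immaterial. *)
Lemma merge_seqE W r : uniq r -> (forall i, i \in r -> c i \notin r) ->
  forall k w, merge_seq W r k w =
  (if k \in r then 0 else W k w + \sum_(i <- r | c i == k) W i w)%R.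
Proof.
elim: r W => [|i r IH] W /=; first by move=> _ _ k w; rewrite big_nil addr0.
move=> /andP[ir ur] cr k w; rewrite /merge_seq/= -/(merge_seq _ r) IH//; last first.
  move=> l lr; have := cr l; rewrite !inE lr orbT => /(_ isT).
  by rewrite negb_or => /andP[].
have := cr i; rewrite !inE eqxx => /(_ isT); rewrite negb_or => /andP[cii cir].
have E (l : K) : l \in r -> merge W i (c i) l w = W l w.
  move=> lr; rewrite /merge; case: eqP => [li|_]; first by rewrite -li lr in ir.
  by case: eqP => // lci; rewrite lci in lr; rewrite lr in cir.
have [kr|kr] := boolP (k \in r); first by rewrite orbT.
have -> : (\sum_(l <- r | c l == k) merge W i (c i) l w =
           \sum_(l <- r | c l == k) W l w)%R.
  rewrite big_seq_cond [RHS]big_seq_cond.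
  by apply: eq_bigr => l /andP[lr _]; exact: E.
rewrite orbF big_cons /merge; have [->|ki] := eqVneq k i.
  rewrite big1_seq ?addr0// => l /andP[/eqP cli lr].
  by have := cr l; rewrite !inE lr orbT cli eqxx => /(_ isT).
by rewrite (eq_sym k (c i)); case: ifP => // /eqP <-; rewrite addrA.
Qed.

Lemma mutually_independent_merge_seq W r :
  (forall k, measurable_fun [set: T] (W k)) ->
  (forall i, i \in r -> c i \notin r) ->
  mutually_independent P W -> mutually_independent P (merge_seq W r).
Proof.
elim: r W => //= i r IH W mW cr Wind; apply: IH.
- exact: measurable_merge.
- move=> l lr; have := cr l; rewrite !inE lr orbT => /(_ isT).
  by rewrite negb_or => /andP[].
- apply: mutually_independent_merge => //.
  have := cr i; rewrite !inE eqxx => /(_ isT).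
  by rewrite negb_or eq_sym => /andP[].
Qed.

End merge_seq.
End merging.
End independence.

(** * Binomial tails *)

Section binomial_tail.
Context {R : realType}.
Implicit Types (x y z : R).

(* The probability that a binomial variable of parameters [N] and [x] is at
   least [k]. *)
Fixpoint binomial_tail (N k : nat) (x : R) : R :=
  match k, N with
  | 0, _ => 1
  | _.+1, 0 => 0
  | k'.+1, N'.+1 => x * binomial_tail N' k' x + (1 - x) * binomial_tail N' k x
  end.

Lemma binomial_tail_ge0 N k x : 0 <= x <= 1 -> 0 <= binomial_tail N k x.
Proof.
move=> /andP[x0 x1]; elim: N k => [|N IH] [|k] //=.
by rewrite addr_ge0// mulr_ge0// subr_ge0.
Qed.

Lemma binomial_tail_le1 N k x : 0 <= x <= 1 -> binomial_tail N k x <= 1.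
Proof.
move=> /andP[x0 x1]; elim: N k => [|N IH] [|k] //=.
by have := IH k; have := IH k.+1; nra.
Qed.

(** A union bound over the sets of [k] successes, with [2 ^ N] in place of the binomial
    coefficient. *)
Lemma binomial_tail_le N k x : 0 <= x <= 1 ->
  binomial_tail N k x <= 2 ^+ N * x ^+ k.
Proof.
move=> /andP[x0 x1]; elim: N k => [|N IH] [|k] /=.
- by rewrite expr0 mul1r.
- by rewrite expr0 mul1r exprn_ge0.
- by rewrite expr0 mulr1 exprn_ege1// ler1n.
have H1 : x * binomial_tail N k x <= 2 ^+ N * x ^+ k.+1.
  by rewrite exprS mulrCA ler_wpM2l.
have H2 : (1 - x) * binomial_tail N k.+1 x <= 2 ^+ N * x ^+ k.+1.
  apply: le_trans (IH k.+1).
  by rewrite ler_piMl ?binomial_tail_ge0 ?x0//; lra.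
by rewrite exprS; lra.
Qed.

(** Changing the success probability of a single trial costs at most [|x - y|]; the trials are
    changed one at a time. *)
Lemma binomial_tail_lipschitz N k x y : 0 <= x <= 1 -> 0 <= y <= 1 ->
  `|binomial_tail N k x - binomial_tail N k y| <= N%:R * `|x - y|.
Proof.
move=> /andP[x0 x1] y01; elim: N k => [|N IH] [|k] /=.
- by rewrite subrr normr0 mul0r.
- by rewrite subrr normr0 mul0r.
- by rewrite subrr normr0 mulr_ge0.
have IH1 := IH k; have IH2 := IH k.+1.
have a0 := binomial_tail_ge0 N k y01; have a1 := binomial_tail_le1 N k y01.
have b0 := binomial_tail_ge0 N k.+1 y01; have b1 := binomial_tail_le1 N k.+1 y01.
move: (binomial_tail N k x) (binomial_tail N k y) IH1 a0 a1 => A a IH1 a0 a1.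
move: (binomial_tail N k.+1 x) (binomial_tail N k.+1 y) IH2 b0 b1 => B b IH2 b0 b1.
rewrite (_ : _ - _ = (x - y) * (a - b) + (x * (A - a) + (1 - x) * (B - b))); last by ring.
have -> : N.+1%:R * `|x - y| = `|x - y| + N%:R * `|x - y|.
  by rewrite -(natr1 N); ring.
apply: (le_trans (ler_normD _ _)); rewrite lerD//; last first.
  apply: (le_trans (ler_normD _ _)); rewrite !normrM.
  by rewrite (ger0_norm x0) (@ger0_norm _ (1 - x)) ?subr_ge0//; nra.
by rewrite normrM ler_piMr// ler_norml; apply/andP; split; lra.
Qed.

(** A mean value inequality: the derivative of the tail at [k + 1] is [N] times the probability of
    exactly [k] successes in [N - 1] trials, of order [z ^ k]. The induction again changes one trial
    at a time. *)
Lemma binomial_tail_diff_le N k x y z : 0 <= x <= z -> 0 <= y <= z -> z <= 1 ->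
  `|binomial_tail N k.+1 x - binomial_tail N k.+1 y| <=
  N%:R * 2 ^+ N * z ^+ k * `|x - y|.
Proof.
move=> /andP[x0 xz] /andP[y0 yz] z1.
have z0 := le_trans x0 xz.
have y01 : 0 <= y <= 1 by rewrite y0 (le_trans yz).
elim: N k => [|N IH] k /=; first by rewrite subrr normr0 !mul0r.
have b0 := binomial_tail_ge0 N k.+1 y01.
have a0 := binomial_tail_ge0 N k y01.
have a1 : binomial_tail N k y <= 2 ^+ N * z ^+ k.
  apply: (le_trans (binomial_tail_le N k y01)).
  by rewrite ler_wpM2l ?exprn_ge0// lerXn2r.
have b1 : binomial_tail N k.+1 y <= 2 ^+ N * z ^+ k.
  apply: (le_trans (binomial_tail_le N k.+1 y01)).
  rewrite ler_wpM2l ?exprn_ge0// exprS.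
  apply: (@le_trans _ _ (y ^+ k)); last by rewrite lerXn2r.
  by rewrite ler_piMl ?exprn_ge0//; case/andP: y01.
have IH2 := IH k.
(* The induction hypothesis for [k] has one power of [z] too few, and the factor [x <= z] restores
   it. For [k = 0] both tails are 1. *)
have IH1 : x * `|binomial_tail N k x - binomial_tail N k y| <=
    N%:R * 2 ^+ N * z ^+ k * `|x - y|.
  case: k {IH2 b0 a0 a1 b1} => [|k].
    by case: (N) => *; rewrite /= subrr normr0 mulr0 !mulr_ge0// exprn_ge0.
  rewrite exprS [leRHS](_ : _ = z * (N%:R * 2 ^+ N * z ^+ k * `|x - y|)).
    by rewrite ler_pM.
  by ring.
move: (binomial_tail N k x) (binomial_tail N k y) IH1 a0 a1 => A a IH1 a0 a1.
move: (binomial_tail N k.+1 x) (binomial_tail N k.+1 y) IH2 b0 b1 => B b IH2 b0 b1.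
rewrite (_ : _ - _ = (x - y) * (a - b) + (x * (A - a) + (1 - x) * (B - b))); last by ring.
have H1 : `|(x - y) * (a - b)| <= 2 ^+ N * z ^+ k * `|x - y|.
  rewrite normrM mulrC ler_wpM2r// ler_norml; apply/andP; split; lra.
have H2 : `|x * (A - a)| <= N%:R * 2 ^+ N * z ^+ k * `|x - y|.
  by rewrite normrM (ger0_norm x0).
have H3 : `|(1 - x) * (B - b)| <= N%:R * 2 ^+ N * z ^+ k * `|x - y|.
  apply: le_trans IH2; rewrite normrM ler_piMl//.
  by rewrite ler_norml; apply/andP; split; lra.
apply: (le_trans (ler_normD _ _)).
apply: (le_trans (lerD H1 (le_trans (ler_normD _ _) (lerD H2 H3)))).
have p0 : 0 <= 2 ^+ N * z ^+ k * `|x - y| by rewrite !mulr_ge0// exprn_ge0.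
rewrite -(natr1 N) exprS.
rewrite [leRHS](_ : _ = 2 * (N%:R * 2 ^+ N * z ^+ k * `|x - y|) +
  2 * (2 ^+ N * z ^+ k * `|x - y|)); last by ring.
lra.
Qed.

End binomial_tail.

(** * Number of successes among independent trials *)

Section counting.
Context d (T : measurableType d) (R : realType) (P : probability T R).
Local Open Scope ereal_scope.
Variables (K : eqType) (W : K -> T -> R) (A : set R) (q : R).
Hypothesis mW : forall k, measurable_fun [set: T] (W k).
Hypothesis mA : measurable A.
Hypothesis q01 : (0 <= q <= 1)%R.

Let preimage_measurable k (B : set R) : measurable B -> measurable (W k @^-1` B).
Proof. by move=> mB; rewrite -[_ @^-1` _]setTI; exact: mW. Qed.

(** [F] records the outcomes of the trials already examined. With the product rule stated relative
    to [F], the induction can split on success or failure of the next trial, as the recursion of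
    [binomial_tail] does. *)
Lemma probability_count_ge (r : seq K) k (F : set T) : measurable F ->
  uniq r -> {in r, forall i, P (W i @^-1` A) = q%:E} ->
  (forall B : K -> set R, (forall i, measurable (B i)) ->
    P (F `&` [set w | forall i, i \in r -> B i (W i w)]) =
    P F * \prod_(i <- r) P (W i @^-1` B i)) ->
  P (F `&` [set w | (k <= count (fun i => W i w \in A) r)%N]) =
  P F * (binomial_tail (size r) k q)%:E /\
  measurable (F `&` [set w | (k <= count (fun i => W i w \in A) r)%N]).
Proof.
elim: r k F => [|i r IH] k F mF.
  move=> _ _ _; case: k => [|k] /=.
    by rewrite (_ : [set w | _] = setT) ?setIT ?mule1//; apply/seteqP; split.
  by rewrite (_ : [set w | _] = set0) ?setI0 ?measure0 ?mule0//; apply/seteqP; split.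
rewrite cons_uniq => /andP[ir ur] Aq rule.
have rB (C : set R) (B : K -> set R) : measurable C ->
    (forall i, measurable (B i)) ->
    P (F `&` W i @^-1` C `&` [set w | forall i, i \in r -> B i (W i w)]) =
    P F * P (W i @^-1` C) * \prod_(i <- r) P (W i @^-1` B i).
  move=> mC mB; pose B' j := if j == i then C else B j.
  have mB' j : measurable (B' j) by rewrite /B'; case: ifP.
  have := rule B' mB'; rewrite big_cons {2}/B' eqxx muleA => H.
  transitivity (P (F `&` [set w | forall j, j \in i :: r -> B' j (W j w)])).
    congr (P _); apply/seteqP; split => w /=.
      move=> [[Fw Cw] Bw]; split => // j; rewrite inE /B'.
      by case: eqP => [->//|_] /= jr; exact: Bw.
    move=> [Fw Bw]; split; first split => //.
      by have := Bw i; rewrite inE eqxx /B' eqxx; exact.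
    move=> j jr; have := Bw j; rewrite inE jr orbT /B'.
    by case: eqP => [ji|_]; [rewrite -ji jr in ir|exact].
  rewrite H; congr (_ * _); rewrite big_seq [RHS]big_seq; apply: eq_bigr => j jr.
  by rewrite /B'; case: eqP => // ji; rewrite -ji jr in ir.
have PF (C : set R) : measurable C -> P (F `&` W i @^-1` C) = P F * P (W i @^-1` C).
  move=> mC; have := rB C (fun=> setT) mC (fun=> measurableT).
  rewrite big1_seq ?mule1; last first.
    by move=> j _; rewrite preimage_setT probability_setT.
  by rewrite (_ : [set w | _] = setT) ?setIT//; apply/seteqP; split.
case: k => [|k].
  by rewrite /= (_ : [set w | _] = setT) ?setIT ?mule1//; apply/seteqP; split.
have mFA : measurable (F `&` W i @^-1` A).
  by apply: measurableI => //; exact: preimage_measurable.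
have mFC : measurable (F `&` W i @^-1` (~` A)).
  by apply: measurableI => //; apply: preimage_measurable; exact: measurableC.
have rS : {in r, forall j, P (W j @^-1` A) = q%:E}.
  by move=> j jr; apply: Aq; rewrite inE jr orbT.
have [H1 m1] := IH k (F `&` W i @^-1` A) mFA ur rS
  (fun B mB => etrans (rB A B mA mB) (congr1 (fun x => x * _) (esym (PF A mA)))).
have mCA := measurableC mA.
have [H2 m2] := IH k.+1 (F `&` W i @^-1` (~` A)) mFC ur rS
  (fun B mB => etrans (rB _ B mCA mB) (congr1 (fun x => x * _) (esym (PF _ mCA)))).
have -> : F `&` [set w | (k.+1 <= count (fun j => W j w \in A) (i :: r))%N] =
   (F `&` W i @^-1` A `&` [set w | (k <= count (fun j => W j w \in A) r)%N]) `|`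
   (F `&` W i @^-1` (~` A) `&` [set w | (k.+1 <= count (fun j => W j w \in A) r)%N]).
  apply/seteqP; split => w /=.
    move=> [Fw]; case: (boolP (W i w \in A)); rewrite ?inE ?notin_setE => Aw.
      by rewrite add1n ltnS => ?; left.
    by rewrite add0n => ?; right.
  move=> [[[Fw Aw] ?]|[[Fw Aw] ?]]; split => //.
    by rewrite (mem_set Aw) add1n.
  by rewrite (memNset Aw) add0n.
split; last exact: measurableU.
rewrite measureU//; last first.
  by apply/seteqP; split => // w /= [[[_ Aw] _] [[_ nAw] _]]; exact: nAw.
apply: (etrans (congr2 _ H1 H2)).
rewrite !PF// Aq ?inE ?eqxx//.
have -> : P (W i @^-1` (~` A)) = (1 - q)%:E.
  rewrite preimage_setC probability_setC; last exact: preimage_measurable.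
  by rewrite Aq ?inE ?eqxx// EFinB.
rewrite -!muleA -ge0_muleDr.
- by rewrite -!EFinM -EFinD.
- by rewrite -EFinM lee_fin mulr_ge0 ?binomial_tail_ge0//; case/andP: q01.
- rewrite -EFinM lee_fin mulr_ge0 ?binomial_tail_ge0// subr_ge0.
  by case/andP: q01.
Qed.

End counting.

(** * Moments from tails *)

Section moments_from_tails.
Context d (T : measurableType d) (R : realType) (P : probability T R).
Local Notation mu := (@lebesgue_measure R).
Local Open Scope ereal_scope.

Implicit Types a t k : R.

(* [min 1 (a / t)^2] for positive [t]. *)
Definition inv_sqr_tail (a t : R) : R :=
  (if t < a then 1 else a ^+ 2 * t `^ (- (1 + 1)))%R.

Lemma inv_sqr_tail_ge0 a t : (0 <= inv_sqr_tail a t)%R.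
Proof. by rewrite /inv_sqr_tail; case: ifP => // _; rewrite mulr_ge0 ?sqr_ge0 ?powR_ge0. Qed.

Lemma measurable_inv_sqr_tail a : measurable_fun [set: R] (inv_sqr_tail a).
Proof.
apply: measurable_fun_ifT => //.
- exact: measurable_fun_ltr.
- by apply: measurable_funM => //; exact: measurable_powR.
Qed.

(** The plateau and the tail contribute [a] each. *)
Lemma integral_inv_sqr_tail a : (0 < a)%R ->
  \int[mu]_(t in `[0%R, +oo[) (inv_sqr_tail a t)%:E = (2 * a)%:E.
Proof.
move=> a0.
have mi : measurable_fun [set: R] (fun t => (inv_sqr_tail a t)%:E).
  by apply/measurable_EFinP; exact: measurable_inv_sqr_tail.
rewrite (@itv_bndbnd_setU _ _ _ (BLeft a))/= ?bnd_simp ?ltW//.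
rewrite ge0_integral_setU//=; last 3 first.
- exact: measurable_funTS.
- by move=> t _; rewrite lee_fin inv_sqr_tail_ge0.
- apply/disj_setPS => t []/=; rewrite !in_itv/= andbT => /andP[_ ta].
  by rewrite leNgt ta.
have E1 : \int[mu]_(t in `[0%R, a[) (inv_sqr_tail a t)%:E = a%:E.
  transitivity (\int[mu]_(t in `[0%R, a[) (cst 1 t)).
    apply: eq_integral => t.
    by rewrite inE/= in_itv/= /inv_sqr_tail => /andP[_ ->].
  by rewrite integral_cst//= lebesgue_measure_itv/= lte_fin a0 sube0 mul1e.
have E2 : \int[mu]_(t in `[a, +oo[) (inv_sqr_tail a t)%:E = a%:E.
  transitivity (\int[mu]_(t in `[a, +oo[) ((a ^+ 2)%:E * (t `^ (- (1 + 1)))%:E)).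
    apply: eq_integral => t; rewrite inE/= in_itv/= /inv_sqr_tail andbT => at_.
    by rewrite ltNge at_.
  rewrite ge0_integralZl//=; last 3 first.
  - by apply/measurable_EFinP; apply: measurable_funTS; exact: measurable_powR.
  - by move=> t _; rewrite lee_fin powR_ge0.
  - by rewrite lee_fin sqr_ge0.
  rewrite integral_powR_tail// -EFinM divr1 powR_inv1 ?ltW//.
  by congr EFin; field; rewrite gt_eqF.
apply: (etrans (congr2 _ E1 E2)).
by rewrite -EFinD; congr EFin; ring.
Qed.

Lemma integral_inv_sqr_tail_le a k (h : R -> \bar R) : (0 < a)%R -> (0 <= k)%R ->
  measurable_fun [set: R] h -> (forall t, 0 <= h t) ->
  (forall t, (0 <= t)%R -> h t <= (k * inv_sqr_tail a t)%:E) ->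
  \int[mu]_(t in `[0%R, +oo[) h t <= (k * (2 * a))%:E.
Proof.
move=> a0 k0 mh h0 hk.
rewrite [leRHS]EFinM -integral_inv_sqr_tail// -ge0_integralZl//=; last 2 first.
- apply: measurable_funTS.
  by apply/measurable_EFinP; exact: measurable_inv_sqr_tail.
- by move=> t _; rewrite lee_fin inv_sqr_tail_ge0.
apply: ge0_le_integral => //.
- exact: measurable_funTS.
- apply: measurable_funTS; apply: emeasurable_funM => //.
  by apply/measurable_EFinP; exact: measurable_inv_sqr_tail.
- by move=> t; rewrite /= in_itv/= andbT => /hk; rewrite EFinM.
Qed.

Variable Y : T -> R.
Hypothesis mY : measurable_fun [set: T] Y.

(** Layer-cake formula for [Y^2]: a fourth-power tail of [|Y|] at scale [a] is an inverse-square
    tail of [Y^2] at scale [a^2]. *)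
Lemma second_moment_le a : (0 < a)%R ->
  (forall t, (a <= t)%R -> P [set w | (t < `|Y w|)%R] <= ((a / t) ^+ 4)%:E) ->
  \int[P]_w ((Y w) ^+ 2)%:E <= (2 * a ^+ 2)%:E.
Proof.
move=> a0 tailY.
have mY2 : measurable_fun [set: T] (fun w => (Y w ^+ 2)%R) by exact: measurable_funX.
pose U : {RV P >-> R} := HB.pack (fun w => (Y w ^+ 2)%R)
  (isMeasurableFun.Build _ _ _ _ _ mY2).
have := @ge0_expectation_ccdf _ _ _ P U (fun w => sqr_ge0 (Y w)).
rewrite expectation_def /= => ->.
rewrite -[(2 * _)%R]mul1r; apply: integral_inv_sqr_tail_le => //.
- by rewrite exprn_gt0.
- exact: ccdf_measurable.
move=> t t0; rewrite mul1r /inv_sqr_tail; case: ltP => [_|at_].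
  exact: probability_le1.
have a2 : (a <= Num.sqrt t)%R.
  by rewrite -(ger0_norm (ltW a0)) -sqrtr_sqr ler_sqrt.
apply: le_trans (le_trans (tailY _ a2) _).
  rewrite /ccdf /distribution /pushforward /= le_measure ?inE//.
  - by rewrite -[_ @^-1` _]setTI; exact: (mY2 measurableT).
  - rewrite (_ : [set w | _] = (fun w => `|Y w|%R) @^-1` `]Num.sqrt t, +oo[%classic).
      rewrite -[_ @^-1` _]setTI.
      exact: (measurableT_comp (@normr_measurable R setT) mY).
    by apply/seteqP; split => w /=; rewrite in_itv/= andbT.
  - move=> w /=; rewrite in_itv/= andbT => tY.
    by rewrite -sqrtr_sqr ltr_sqrt// (le_lt_trans t0).
rewrite lee_fin powRN (_ : (1 + 1 = 2%:R)%R)// powR_mulrn//.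
by rewrite -[4%N]/(2 * 2)%N exprM !expr_div_n sqr_sqrtr.
Qed.

(** The layer-cake formula for the positive and the negative part turns the mean into the integral
    of the difference of the two tails. Two one-sided hypotheses avoid subtracting extended reals
    under the integral. *)
Lemma expectation_le a k : (0 < a)%R -> (0 <= k)%R ->
  P.-integrable [set: T] (EFin \o Y) ->
  (forall t, (0 <= t)%R -> P [set w | (t < Y w)%R] <=
     P [set w | (Y w < - t)%R] + (k * inv_sqr_tail a t)%:E) ->
  (forall t, (0 <= t)%R -> P [set w | (Y w < - t)%R] <=
     P [set w | (t < Y w)%R] + (k * inv_sqr_tail a t)%:E) ->
  (`|fine (\int[P]_w (Y w)%:E)| <= k * (2 * a))%R.
Proof.
move=> a0 k0 iY tail1 tail2.
pose Yp w := Num.max (Y w) 0%R; pose Yn w := Num.max (- Y w)%R 0%R.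
have mYp : measurable_fun [set: T] Yp by exact: measurable_maxr.
have mYn : measurable_fun [set: T] Yn.
  by apply: measurable_maxr => //; exact: measurable_funN.
pose Up : {RV P >-> R} := HB.pack Yp (isMeasurableFun.Build _ _ _ _ _ mYp).
pose Un : {RV P >-> R} := HB.pack Yn (isMeasurableFun.Build _ _ _ _ _ mYn).
have Ep : \int[P]_w (Yp w)%:E = \int[mu]_(t in `[0%R, +oo[) ccdf Up t.
  rewrite -ge0_expectation_ccdf ?expectation_def// => w.
  by rewrite /= /Yp le_max lexx orbT.
have En : \int[P]_w (Yn w)%:E = \int[mu]_(t in `[0%R, +oo[) ccdf Un t.
  rewrite -ge0_expectation_ccdf ?expectation_def// => w.
  by rewrite /= /Yn le_max lexx orbT.
have cp t : (0 <= t)%R -> ccdf Up t = P [set w | (t < Y w)%R].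
  move=> t0; rewrite /ccdf /distribution /pushforward /=; congr (P _).
  by apply/seteqP; split => w /=; rewrite in_itv/= andbT /Yp lt_max (ltNge t 0%R) t0 orbF.
have cn t : (0 <= t)%R -> ccdf Un t = P [set w | (Y w < - t)%R].
  move=> t0; rewrite /ccdf /distribution /pushforward /=; congr (P _).
  apply/seteqP; split => w /=; rewrite in_itv/= andbT /Yn lt_max (ltNge t 0%R) t0 orbF;
  by rewrite ltrNr.
have mg : measurable_fun [set: R] (fun t => (k * inv_sqr_tail a t)%:E).
  by apply/measurable_EFinP/measurable_funM => //; exact: measurable_inv_sqr_tail.
have g0 t : 0 <= (k * inv_sqr_tail a t)%:E.
  by rewrite lee_fin mulr_ge0// inv_sqr_tail_ge0.
have key (c1 c2 : R -> \bar R) : measurable_fun [set: R] c1 -> (forall t, 0 <= c1 t) ->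
    measurable_fun [set: R] c2 -> (forall t, 0 <= c2 t) ->
    (forall t, (0 <= t)%R -> c1 t <= c2 t + (k * inv_sqr_tail a t)%:E) ->
    \int[mu]_(t in `[0%R, +oo[) c1 t <=
    \int[mu]_(t in `[0%R, +oo[) c2 t + (k * (2 * a))%:E.
  move=> m1 c10 m2 c20 c12.
  apply: (@le_trans _ _ (\int[mu]_(t in `[0%R, +oo[) (c2 t + (k * inv_sqr_tail a t)%:E))).
    apply: ge0_le_integral => //.
    - exact: measurable_funTS.
    - by apply: measurable_funTS; exact: emeasurable_funD.
    - by move=> t; rewrite /= in_itv/= andbT; exact: c12.
  rewrite ge0_integralD//=; last 2 first.
  - exact: measurable_funTS.
  - exact: measurable_funTS.
  by rewrite leeD2l// integral_inv_sqr_tail_le.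
have K1 : \int[P]_w (Yp w)%:E <= \int[P]_w (Yn w)%:E + (k * (2 * a))%:E.
  rewrite Ep En; apply: key; try exact: ccdf_measurable; try by [].
  by move=> t t0; rewrite cp// cn//; exact: tail1.
have K2 : \int[P]_w (Yn w)%:E <= \int[P]_w (Yp w)%:E + (k * (2 * a))%:E.
  rewrite Ep En; apply: key; try exact: ccdf_measurable; try by [].
  by move=> t t0; rewrite cp// cn//; exact: tail2.
have posE : (fun w => (Yp w)%:E) = (EFin \o Y)^\+ .
  by apply/funext => w; rewrite funeposE /= /Yp EFin_max.
have negE : (fun w => (Yn w)%:E) = (EFin \o Y)^\- .
  by apply/funext => w; rewrite funenegE /= /Yn EFin_max.
have := integrable_pos_fin_num measurableT iY.
have := integrable_neg_fin_num measurableT iY.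
rewrite (integralE _ _ (EFin \o Y)) -posE -negE.
case: (\int[P]_w (Yp w)%:E) K1 K2 => [x| |] //; case: (\int[P]_w (Yn w)%:E) => [y| |] //.
rewrite -!EFinD !lee_fin => K1 K2 _ _ /=.
by rewrite ler_norml; apply/andP; split; lra.
Qed.

End moments_from_tails.

(** * Order statistics and sums of independent variables *)

Section order_statistic.
Context {R : realType}.
Implicit Types (s : seq R) (t : R).

(** After sorting, if position [m] lies above [t], so do the [m + 1] positions from [m] to [2 m];
    otherwise only the [m] positions after it can. *)
Lemma lt_nth_sort s m t : size s = (2 * m).+1 ->
  (t < nth 0 (sort <=%R s) m) = (m < count (fun x => (t < x)%R) s)%N.
Proof.
move=> sz; have /permP cE : perm_eq (sort <=%R s) s by rewrite perm_sort.
rewrite -(cE (fun x => t < x)).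
have sz' : size (sort <=%R s) = (2 * m).+1 by rewrite size_sort.
have srt : sorted <=%R (sort <=%R s) by exact: sort_le_sorted.
move: {cE} (sort <=%R s) sz' srt => {sz}{}s sz srt.
have ms : (m < size s)%N by rewrite sz; lia.
have nthle i j : (i <= j)%N -> (j < size s)%N -> nth 0 s i <= nth 0 s j.
  move=> ij js; apply: (@sorted_leq_nth _ <=%R le_trans lexx 0 s srt) => //.
  by rewrite inE (leq_ltn_trans ij).
apply/idP/idP => tn.
  rewrite -[s](cat_take_drop m) count_cat.
  have -> : count (fun x => t < x) (drop m s) = size (drop m s).
    apply/eqP; rewrite -all_count; apply/(all_nthP 0) => i.
    rewrite size_drop nth_drop => im; apply: (lt_le_trans tn).
    by apply: nthle; rewrite ?leq_addr -?ltn_subRL.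
  by rewrite size_drop sz; lia.
rewrite ltNge; apply/negP => nt; move: tn; apply/negP; rewrite -leqNgt.
rewrite -[s](cat_take_drop m.+1) count_cat.
have -> : count (fun x => t < x) (take m.+1 s) = 0%N.
  apply/eqP; rewrite eqn0Ngt -has_count; apply/hasPn => x /(nthP 0)[i].
  rewrite size_takel// => im <-; rewrite nth_take// -leNgt.
  by apply: le_trans nt; exact: nthle.
rewrite add0n; apply: (leq_trans (count_size _ _)).
by rewrite size_drop sz; lia.
Qed.

(** Mirror image: the [m + 1] positions that count are now 0 to [m]. *)
Lemma nth_sort_lt s m t : size s = (2 * m).+1 ->
  (nth 0 (sort <=%R s) m < t) = (m < count (fun x => (x < t)%R) s)%N.
Proof.
move=> sz; have /permP cE : perm_eq (sort <=%R s) s by rewrite perm_sort.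
rewrite -(cE (fun x => x < t)).
have sz' : size (sort <=%R s) = (2 * m).+1 by rewrite size_sort.
have srt : sorted <=%R (sort <=%R s) by exact: sort_le_sorted.
move: {cE} (sort <=%R s) sz' srt => {sz}{}s sz srt.
have ms : (m < size s)%N by rewrite sz; lia.
have nthle i j : (i <= j)%N -> (j < size s)%N -> nth 0 s i <= nth 0 s j.
  move=> ij js; apply: (@sorted_leq_nth _ <=%R le_trans lexx 0 s srt) => //.
  by rewrite inE (leq_ltn_trans ij).
apply/idP/idP => tn.
  rewrite -[s](cat_take_drop m.+1) count_cat.
  have -> : count (fun x => x < t) (take m.+1 s) = size (take m.+1 s).
    apply/eqP; rewrite -all_count; apply/(all_nthP 0) => i.
    rewrite size_takel// => im; rewrite nth_take//; apply: le_lt_trans tn.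
    exact: nthle.
  by rewrite size_takel// ltn_addr.
rewrite ltNge; apply/negP => nt; move: tn; apply/negP; rewrite -leqNgt.
rewrite -[s](cat_take_drop m) count_cat.
have -> : count (fun x => x < t) (drop m s) = 0%N.
  apply/eqP; rewrite eqn0Ngt -has_count; apply/hasPn => x /(nthP 0)[i].
  rewrite size_drop nth_drop => im <-; rewrite -leNgt.
  by apply: (le_trans nt); apply: nthle; rewrite ?leq_addr -?ltn_subRL.
rewrite addn0; apply: (leq_trans (count_size _ _)).
by rewrite size_takel// ltnW.
Qed.

End order_statistic.

Lemma sum_block (V : nmodType) (N n : nat) (j : 'I_N) (F : nat -> V) :
  \sum_(i < N * n | (i %/ n)%N == j) F i = \sum_(i < n) F (j * n + i)%N.
Proof.
have [->|n0] := posnP n.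
  by rewrite big_ord0 big1// => -[i +]; rewrite muln0.
have lt_block (i : 'I_n) : (j * n + i < N * n)%N.
  by have := ltn_ord i; have := ltn_ord j; nia.
pose h (i : 'I_n) : 'I_(N * n) := Ordinal (lt_block i).
pose h' (i : 'I_(N * n)) : 'I_n := Ordinal (ltn_pmod i n0).
rewrite (reindex_onto h h')/=; last first.
  by move=> i /eqP ij; apply: val_inj; rewrite /= -ij -divn_eq.
apply: eq_bigl => i; rewrite divnMDl// divn_small// addn0 eqxx/=.
by apply/eqP/val_inj; rewrite /= modnMDl modn_small.
Qed.

(** * Averaging against an even density *)

Section odd_symmetry.
Context {R : realType}.
Local Notation mu := (@lebesgue_measure R).
Local Open Scope ereal_scope.

(** Reflecting the integration variable in one of the two averages shows that an even weight of mass
    1 preserves the relation [g v + g (- v) = c]. At [x = 0] it gives half of [c]. *)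
Lemma iter_averaging_sym (s : R -> R) (g : R -> \bar R) (c : R) n x :
  measurable_fun [set: R] s -> (forall v, 0 <= s v)%R ->
  (forall v, s (- v) = s v)%R -> \int[mu]_v (s v)%:E = 1 -> (0 <= c)%R ->
  measurable_fun [set: R] g -> (forall v, 0 <= g v) ->
  (forall v, g v + g (- v)%R = c%:E) ->
  iter n (averaging s) g x + iter n (averaging s) g (- x)%R = c%:E.
Proof.
move=> ms s0 sN s1 c0 mg g0 gc; elim: n x => [|n IH] x; first exact: gc.
rewrite !iterS; have := measurable_iter_averaging ms s0 n mg g0.
move: (iter n (averaging s) g) IH => f fc [mf f0].
have mfx y : measurable_fun [set: R] (fun v => f (y + v)%R * (s v)%:E).
  exact: measurable_averaging_integrand.
have fs0 y v : 0 <= f (y + v)%R * (s v)%:E by rewrite mule_ge0 ?lee_fin.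
have mN : measurable_fun [set: R] (fun v => f (- x + - v)%R * (s (- v))%:E).
  by have := measurableT_comp (mfx (- x)%R) (@oppr_measurable R setT).
rewrite {2}/averaging -(ge0_integral_opp (mfx _) (fs0 _)) /averaging.
rewrite -(ge0_integralD mu measurableT (fun v _ => fs0 x v) (mfx x)
  (fun v _ => fs0 (- x)%R (- v)%R) mN).
transitivity (\int[mu]_v (c%:E * (s v)%:E)).
  apply: eq_integral => v _; rewrite sN -opprD -ge0_muleDl//.
  by rewrite fc.
rewrite ge0_integralZl//=; last 2 first.
- exact/measurable_EFinP.
- by move=> v _; rewrite lee_fin.
by rewrite s1 mule1.
Qed.

Lemma iter_averaging_sym0 (s : R -> R) (g : R -> \bar R) n :
  measurable_fun [set: R] s -> (forall v, 0 <= s v)%R ->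
  (forall v, s (- v) = s v)%R -> \int[mu]_v (s v)%:E = 1 ->
  measurable_fun [set: R] g -> (forall v, 0 <= g v) ->
  (forall v, g v + g (- v)%R = 2%:E) ->
  iter n (averaging s) g 0%R = 1.
Proof.
move=> ms s0 sN s1 mg g0 gc.
have := @iter_averaging_sym s g 2 n 0%R ms s0 sN s1 (ler0n R 2) mg g0 gc.
rewrite oppr0; case: (iter _ _ _ _) => [y| |]//; rewrite -EFinD => -[yy].
by congr EFin; lra.
Qed.

End odd_symmetry.

(** * Laws of sums of independent variables *)

Section law_of_sum.
Context d (T : measurableType d) (R : realType) (P : probability T R).
Local Notation mu := (@lebesgue_measure R).
Local Open Scope ereal_scope.

Lemma mutually_independent_map d1 (T1 : measurableType d1) d2
    (T2 : measurableType d2) (K : finType)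
    (X : K -> T -> T1) (f : K -> T1 -> T2) :
  (forall k, measurable_fun [set: T1] (f k)) ->
  mutually_independent P X ->
  mutually_independent P (fun k w => f k (X k w)).
Proof.
move=> mf Xind A mA.
have mfA k : measurable (f k @^-1` A k).
  by rewrite -[_ @^-1` _]setTI; exact: mf.
exact: (Xind (fun k => f k @^-1` A k) mfA).
Qed.

Lemma ge0_integral_has_density (X : T -> R) (p : R -> R) (g : R -> \bar R) :
  measurable_fun [set: T] X -> has_density P X p ->
  measurable_fun [set: R] g -> (forall x, 0 <= g x) ->
  \int[P]_w g (X w) = \int[mu]_x (g x * (p x)%:E).
Proof.
move=> mX [mp p0 pX] mg g0.
have mX' : measurable_fun [set: T] (X : T -> measurableTypeR R) by [].
transitivity (\int[pushforward P (X : T -> measurableTypeR R)]_x g x).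
  by rewrite (ge0_integral_pushforward mX').
exact: (@ge0_integral_density _ (measurableTypeR R) R mu
  (pushforward P (X : T -> measurableTypeR R)) p).
Qed.

Variables (K : finType) (W : K -> T -> R) (p : R -> R).
Hypothesis mW : forall k, measurable_fun [set: T] (W k).
Hypothesis Wind : mutually_independent P W.

(** Merging all of [r] into [k0] leaves the variable at [k] untouched. *)
Lemma independent_sum_pair k0 r k : uniq (k0 :: r) -> k \notin k0 :: r ->
  forall A B, measurable A -> measurable B ->
  P ((fun w => W k0 w + \sum_(i <- r) W i w)%R @^-1` A `&` W k @^-1` B) =
  P ((fun w => W k0 w + \sum_(i <- r) W i w)%R @^-1` A) * P (W k @^-1` B).
Proof.
move=> /= /andP[k0r ur]; rewrite inE negb_or => /andP[kk0 kr] A B mA mB.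
pose c (_ : K) := k0.
have cr i : i \in r -> c i \notin r by [].
have Mind := mutually_independent_merge_seq mW cr Wind.
have k0k : k0 != k by rewrite eq_sym.
have := mutually_independent_pair Mind k0k mA mB.
have -> : merge_seq c W r k = W k.
  apply/funext => w; rewrite merge_seqE// (negbTE kr) big1 ?addr0// => i.
  by rewrite /c (negbTE k0k).
have -> // : merge_seq c W r k0 = (fun w => W k0 w + \sum_(i <- r) W i w)%R.
apply/funext => w; rewrite merge_seqE// (negbTE k0r) /c; congr (_ + _)%R.
by apply: eq_bigl => i; rewrite eqxx.
Qed.

Lemma measurable_sum_seq k0 r :
  measurable_fun [set: T] (fun w => W k0 w + \sum_(i <- r) W i w)%R.
Proof. by apply: measurable_funD => //; exact: measurable_sum. Qed.

(** Freezing all summands but the last and integrating that one replaces [g] by its averaging. The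
    first index is kept apart because it receives the merged sum. *)
Lemma integral_independent_sum k0 r g : uniq (k0 :: r) ->
  {in k0 :: r, forall i, has_density P (W i) p} ->
  measurable_fun [set: R] g -> (forall x, 0 <= g x) ->
  \int[P]_w g (W k0 w + \sum_(i <- r) W i w)%R =
  iter (size r).+1 (averaging p) g 0%R.
Proof.
elim/last_ind: r g => [|r k IH] g u Wp mg g0.
  under eq_integral do rewrite big_nil addr0.
  rewrite (@ge0_integral_has_density _ p)//; last by apply: Wp; rewrite mem_head.
  by apply: eq_integral => x _; rewrite add0r.
move: u; rewrite -rcons_cons rcons_uniq => /andP[kr u].
have [mp p0 _] : has_density P (W k) p.
  by apply: Wp; rewrite inE mem_rcons mem_head orbT.
rewrite size_rcons iterSr -IH//; last 3 first.
- by move=> i ir; apply: Wp; rewrite -rcons_cons mem_rcons inE ir orbT.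
- exact: measurable_averaging.
- exact: averaging_ge0.
have mS := measurable_sum_seq k0 r.
under eq_integral do rewrite -cats1 big_cat big_seq1 addrA.
have mgD : measurable_fun [set: R * R] (fun z : R * R => g (z.1 + z.2)%R).
  by apply: (measurableT_comp mg); exact: measurable_funD.
rewrite (independent_integral mS (mW k) (independent_sum_pair u kr) mgD)//=.
apply: eq_integral => w _.
rewrite (@ge0_integral_has_density _ p (fun y => g (_ + y)%R))//.
- by apply: Wp; rewrite inE mem_rcons mem_head orbT.
- by apply: (measurableT_comp mg); exact: measurable_funD.
Qed.

End law_of_sum.

(** * The smoothed mean of one block *)

Section scales.
Context {R : realType}.
Variable n : nat.

(** Integrated over [|u| > n t], the bound on [s^{*n}] gives at most
    [2 B / (beta n^(beta - 1) t^beta)], hence at most [(tail_scale / t)^beta]. *)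
Definition tail_scale (B beta : R) : R :=
  (2 `^ beta * B / (beta * n%:R `^ (beta - 1))) `^ (1 / beta).

Lemma tail_scaleX (B beta : R) : 0 < B -> 0 < beta ->
  tail_scale B beta `^ beta = 2 `^ beta * B / (beta * n%:R `^ (beta - 1)).
Proof.
move=> B0 beta0; rewrite -powRrM div1r mulVf ?gt_eqF// powRr1//.
by rewrite divr_ge0 ?mulr_ge0 ?powR_ge0 ?(ltW B0) ?(ltW beta0).
Qed.

Lemma tail_scale_gt0 (B beta : R) : (0 < n)%N -> 0 < B -> 0 < beta ->
  0 < tail_scale B beta.
Proof.
by move=> n0 B0 b0; rewrite powR_gt0// divr_gt0 ?mulr_gt0 ?powR_gt0 ?ltr0n.
Qed.

(* The conditional probability that the smoothed mean exceeds [t], given that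
   the block sum is [v]. *)
Definition gauss_shift (theta t v : R) : R :=
  normal_tail (- (n%:R * theta)^-1 * v + t / theta).

Lemma measurable_gauss_shift theta t :
  measurable_fun [set: R] (gauss_shift theta t).
Proof.
apply: (measurableT_comp (@measurable_normal_tail R)).
by apply: measurable_funD => //; exact: measurable_funM.
Qed.

End scales.

Section block.
Context d (T : measurableType d) (R : realType) (P : probability T R).
Local Notation mu := (@lebesgue_measure R).
Variables (K : finType) (W : K -> T -> R) (p : R -> R).
Hypothesis mW : forall k, measurable_fun [set: T] (W k).
Hypothesis Wind : mutually_independent P W.
Variables (k0 : K) (r : seq K) (ke : K).
Hypothesis k0r_uniq : uniq (k0 :: r).
Hypothesis ker : ke \notin k0 :: r.
Hypothesis Wp : {in k0 :: r, forall i, has_density P (W i) p}.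
Hypothesis Wgauss : forall A, measurable A ->
  P (W ke @^-1` A) = normal_prob 0 1 A.
Variables (M B beta theta : R).
Hypothesis int_ur : (\int[mu]_u (u * odd_part p u)%:E = 0)%E.
Hypothesis int_u2r :
  (\int[mu]_u (u ^+ 2 * `|odd_part p u|)%:E <= M%:E)%E.
Hypothesis B0 : 0 < B.
Hypothesis beta1 : 1 <= beta.
Let n := (size r).+1.
Hypothesis conv_le : forall v : R,
  (convolution_pow (EFin \o even_part p) n v <=
   (B * n%:R / (n%:R `^ ((beta + 1) / beta) + `|v| `^ (1 + beta)))%:E)%E.
Hypothesis theta0 : 0 < theta.
Hypothesis M_le : 2 * M <= theta ^+ 2 * n%:R.

Local Notation tail_scale := (tail_scale n B beta).
Local Notation gauss_shift := (gauss_shift n theta).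

Definition block_sum w := W k0 w + \sum_(i <- r) W i w.
Definition smoothed_mean w := n%:R^-1 * block_sum w + theta * W ke w.

Let n0 : 0 < n%:R :> R. Proof. by rewrite ltr0n. Qed.
Let beta0 : 0 < beta. Proof. exact: lt_le_trans beta1. Qed.

Let densP : [/\ measurable_fun [set: R] p, forall v, 0 <= p v &
  (\int[mu]_v (p v)%:E = 1)%E].
Proof.
have [mp p0 pW] := Wp (mem_head _ _); split => //.
by rewrite -(pW setT measurableT) preimage_setT probability_setT.
Qed.

Let mp : measurable_fun [set: R] p. Proof. by case: densP. Qed.
Let p0 v : 0 <= p v. Proof. by case: densP. Qed.
Let p1 : (\int[mu]_v (p v)%:E = 1)%E. Proof. by case: densP. Qed.

Let M0 : 0 <= M.
Proof.
rewrite -lee_fin; apply: le_trans int_u2r.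
by apply: integral_ge0 => v _; rewrite lee_fin mulr_ge0// sqr_ge0.
Qed.

Let mS : measurable_fun [set: T] block_sum.
Proof. exact: measurable_sum_seq. Qed.

Lemma measurable_smoothed_mean : measurable_fun [set: T] smoothed_mean.
Proof. by apply: measurable_funD; exact: measurable_funM. Qed.

Lemma expectation_block_sum_le (Kg b : R) (g : R -> R) : 0 <= Kg -> measurable_fun [set: R] g ->
  (forall x, 0 <= g x) -> (forall x, g x <= b) -> quadratic_remainder Kg g ->
  (\int[P]_w (g (block_sum w))%:E <=
   \int[mu]_v ((g v)%:E * convolution_pow (EFin \o even_part p) n v)
   + (Kg * M *+ n)%:E)%E.
Proof.
move=> Kg0 mg g0 gb gK.
rewrite (@integral_independent_sum _ _ _ P _ W p mW Wind k0 r (EFin \o g))//;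
  last exact/measurable_EFinP.
exact: (iter_averaging_even_part_cmp mp p0 p1 int_ur int_u2r Kg0 mg g0 gb gK).
Qed.

(** Only [t / 2] is spent on the block sum; the other half is left for the Gaussian. The first term
    is the symmetric tail, the second the exchange error. *)
Lemma block_sum_tail (t : R) : 0 < t ->
  (P [set w | n%:R * t / 2 <= `|block_sum w|]%R <=
   (16 * (2 * tail_scale / t) `^ beta + 100 * theta ^+ 2 / t ^+ 2)%:E)%E.
Proof.
(* With this scale the bump is at least 1 where [|S| >= n t / 2] and vanishes where
   [|S| <= n t / 4]. *)
move=> t0; pose c := 2 / (n%:R * t).
have nt0 : 0 < n%:R * t by exact: mulr_gt0.
have c0 : 0 < c by exact: divr_gt0.
pose g v := bump (c * v + 0).
have mg : measurable_fun [set: R] g.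
  apply: (measurableT_comp (@measurable_bump R)).
  by apply: measurable_funD => //; exact: measurable_funM.
have gK : quadratic_remainder (50 * c ^+ 2) g.
  by apply: quadratic_remainder_affine; exact: bump_quadratic_remainder.
have g0 v : 0 <= g v by exact: bump_ge0.
have mE : measurable [set w | n%:R * t / 2 <= `|block_sum w|].
  rewrite (_ : [set w | _] = (fun w => `|block_sum w|) @^-1` `[n%:R * t / 2, +oo[%classic).
    rewrite -[_ @^-1` _]setTI.
    exact: (measurableT_comp (@normr_measurable R setT) mS).
  by apply/seteqP; split => w /=; rewrite in_itv/= andbT.
apply: (@le_trans _ _ (\int[P]_w (g (block_sum w))%:E)%E).
  rewrite -[X in P X]setIT -integral_indic//.
  apply: ge0_le_integral => //.
  - by apply/measurable_EFinP; exact: measurable_indic.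
  - by apply/measurable_EFinP; exact: (measurableT_comp mg).
  - move=> w _; rewrite lee_fin indicE; case: (boolP (_ \in _)); last by [].
    rewrite inE/= => Sw; apply: bump_ge1; rewrite addr0 normrM gtr0_norm//.
    rewrite /c mulrAC ler_pdivlMr// mul1r; lra.
apply: (le_trans (expectation_block_sum_le _ mg g0 (fun v => bump_le8 _) gK)).
  by rewrite mulr_ge0// sqr_ge0.
(* The exchange error is [n * 50 c^2 * M = 200 M / (n t^2)], and [2 M <= theta^2 n]. *)
rewrite EFinD; apply: leeD; last first.
  rewrite lee_fin -mulr_natr /c expr_div_n exprMn ler_pdivlMr ?exprn_gt0//.
  rewrite [leLHS](_ : _ = (100 / n%:R) * (2 * M)); last first.
    by field; rewrite !gt_eqF.
  rewrite (_ : 100 * theta ^+ 2 = (100 / n%:R) * (theta ^+ 2 * n%:R)).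
    by rewrite ler_wpM2l// divr_ge0// ltW.
  by field; rewrite gt_eqF.
have [mc cge0] := measurable_convolution_pow (measurable_even_part mp)
  (even_part_ge0 p0) (ltn0Sn (size r)).
have tailI := @integral_sym_tail_le R
  (fun v => (g v)%:E * convolution_pow (EFin \o even_part p) n v)%E
  (8 * (B * n%:R)) (n%:R * t / 4) beta.
apply: (le_trans (tailI _ _ _ _ _ _ _)).
- by rewrite divr_gt0.
- exact: beta1.
- by rewrite !mulr_ge0// ltW.
- by apply: emeasurable_funM => //; exact/measurable_EFinP.
- by move=> v; rewrite mule_ge0 ?lee_fin.
- move=> v va; rewrite /g bump_eq0 ?mul0e// addr0 normrM gtr0_norm//.
  rewrite /c mulrAC ler_pdivrMr//.
  by lra.
- move=> v va; have v0 : 0 < `|v| by apply: lt_le_trans va; rewrite divr_gt0.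
  have -> : (8 * (B * n%:R) * `|v| `^ (- (1 + beta)))%:E =
    (8%:E * (B * n%:R * `|v| `^ (- (1 + beta)))%:E)%E
    by rewrite -EFinM; congr EFin; ring.
  apply: lee_pmul => //; [by rewrite lee_fin|by rewrite lee_fin; exact: bump_le8|].
  apply: (le_trans (conv_le v)).
  rewrite lee_fin powRN ler_wpM2l//; first by rewrite ltW// mulr_gt0.
  rewrite lef_pV2 ?posrE ?addr_gt0 ?powR_gt0//.
  by rewrite lerDr powR_ge0.
(* Here 16 is the bound 8 on the bump times two half-lines. Of [4^beta = 2^beta 2^beta], coming from
   the radius [n t / 4], one factor belongs to [tail_scale] and the other to [2 * tail_scale]. *)
rewrite lee_fin le_eqVlt; apply/orP; left; apply/eqP.
have n_pow : n%:R `^ beta = n%:R * n%:R `^ (beta - 1) by rewrite mulr_powRB1// ltW.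
have four_pow : 4 `^ beta = 2 `^ beta * 2 `^ beta :> R.
  by rewrite -powRM// -natrM.
have p4 : 4 `^ beta != 0 :> R by rewrite gt_eqF// powR_gt0.
have pt : t `^ beta != 0 by rewrite gt_eqF// powR_gt0.
have a_pow : (n%:R * t / 4) `^ beta = n%:R `^ beta * t `^ beta / 4 `^ beta.
  apply: (mulIf p4).
  rewrite divfK//.
  by rewrite -!powRM ?mulr_ge0 ?divr_ge0 ?mulr_ge0 ?divfK ?(ltW n0) ?(ltW t0).
have d_pow : (2 * tail_scale / t) `^ beta = 2 `^ beta * tail_scale `^ beta / t `^ beta.
  apply: (mulIf pt).
  have D0 := ltW (tail_scale_gt0 (ltn0Sn (size r)) B0 beta0).
  rewrite divfK//.
  rewrite -!powRM ?mulr_ge0 ?invr_ge0 ?(ltW t0)//.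
  by rewrite divfK// gt_eqF.
rewrite powRN a_pow d_pow (tail_scaleX n B0 beta0) n_pow four_pow.
have := powR_gt0 beta (ltr0n R 2); have := powR_gt0 (beta - 1) n0.
have := powR_gt0 beta t0.
move: (2 `^ beta) (n%:R `^ (beta - 1)) (t `^ beta) => x y z z0 y0 x0.
by field; rewrite !gt_eqF.
Qed.

(** Below [2 D] or [theta] the right side exceeds 1. Above both, the bases [2 D / t] and [theta / t]
    are at most 1, so their powers are at most the bases. For [theta / t] the coefficients are 100
    from the block sum and 8 from the two Gaussian tails; for [D / t], 32 suffices. *)
Lemma smoothed_mean_tail (t : R) : 0 < t ->
  (P [set w | t < `|smoothed_mean w|]%R <=
   (108 * (tail_scale + theta) / t)%:E)%E.
Proof.
move=> t0; have D0 := (tail_scale_gt0 (ltn0Sn (size r)) B0 beta0); have th0 := theta0.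
have mX : measurable_fun [set: T] (fun w => `|smoothed_mean w|).
  apply: (measurableT_comp (@normr_measurable R setT)).
  exact: measurable_smoothed_mean.
have mE : measurable [set w | t < `|smoothed_mean w|].
  rewrite (_ : [set w | _] = (fun w => `|smoothed_mean w|) @^-1` `]t, +oo[%classic).
    by rewrite -[_ @^-1` _]setTI; exact: mX.
  by apply/seteqP; split => w /=; rewrite in_itv/= andbT.
have [tD|Dt] := ltP t (2 * tail_scale).
  apply: (le_trans (probability_le1 _ mE)); rewrite lee_fin ler_pdivlMr//; lra.
have [tth|tht] := ltP t theta.
  apply: (le_trans (probability_le1 _ mE)); rewrite lee_fin ler_pdivlMr//; lra.
pose y := t / (2 * theta).
have y0 : 0 < y by rewrite divr_gt0// mulr_gt0.
pose F := [set w | n%:R * t / 2 <= `|block_sum w|].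
pose Gp := W ke @^-1` `]y, +oo[%classic.
pose Gn := W ke @^-1` `]-oo, - y[%classic.
have mF : measurable F.
  rewrite (_ : F = (fun w => `|block_sum w|) @^-1` `[n%:R * t / 2, +oo[%classic).
    rewrite -[_ @^-1` _]setTI.
    exact: (measurableT_comp (@normr_measurable R setT) mS).
  by apply/seteqP; split => w /=; rewrite in_itv/= andbT.
have mGp : measurable Gp by rewrite -[Gp]setTI; exact: mW.
have mGn : measurable Gn by rewrite -[Gn]setTI; exact: mW.
apply: (@le_trans _ _ (P (F `|` (Gp `|` Gn)))).
  rewrite le_measure ?inE//; first by apply: measurableU => //; exact: measurableU.
  move=> w /= tX; have [Fw|nF] := leP (n%:R * t / 2) `|block_sum w|; [by left|right].
  rewrite /Gp /Gn /= !in_itv/= andbT.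
  have S2 : `|n%:R^-1 * block_sum w| < t / 2.
    by rewrite normrM gtr0_norm ?invr_gt0// ltr_pdivrMl// mulrA.
  have : t / 2 < `|theta * W ke w|.
    by have := le_lt_trans (lexx _) (lt_le_trans tX (ler_normD _ _)); lra.
  rewrite normrM gtr0_norm// => H.
  have : y < `|W ke w| by rewrite /y ltr_pdivrMr ?mulr_gt0//; lra.
  by rewrite ltr_normr ltrNr => /orP[->|->]; [left|right].
apply: (le_trans (measureU2 P mF (measurableU _ _ mGp mGn))).
apply: (@le_trans _ _ ((16 * (2 * tail_scale / t) `^ beta +
    100 * theta ^+ 2 / t ^+ 2)%:E + (2 / y + 2 / y)%:E)%E).
  apply: leeD; first exact: block_sum_tail.
  apply: (le_trans (measureU2 P mGp mGn)); rewrite EFinD; apply: leeD.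
    rewrite [leLHS]Wgauss//.
    by rewrite [X in (X <= _)%E]normal_tailE lee_fin normal_tail_le.
  rewrite [leLHS]Wgauss//.
  by rewrite [X in (X <= _)%E]normal_probNy opprK lee_fin normal_tail_le.
rewrite -EFinD lee_fin /y invf_div.
have H1 : (2 * tail_scale / t) `^ beta <= 2 * tail_scale / t.
  have D1 : 0 < 2 * tail_scale / t <= 1.
    by rewrite ler_pdivrMr// mul1r Dt divr_gt0 ?mulr_gt0.
  rewrite -[leRHS]powRr1; last by case/andP: D1 => /ltW.
  exact: ger_powR.
have H2 : theta ^+ 2 / t ^+ 2 <= theta / t.
  rewrite -expr_div_n expr2 ler_piMr// ?divr_ge0 ?(ltW t0) ?(ltW theta0)//.
  by rewrite ler_pdivrMr// mul1r.
have -> : 108 * (tail_scale + theta) / t = 108 * (tail_scale / t) + 108 * (theta / t).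
  by field; rewrite gt_eqF.
have d1 : 0 <= tail_scale / t by rewrite divr_ge0 ?ltW.
move: H1; rewrite -[2 * tail_scale / t]mulrA.
rewrite -[100 * theta ^+ 2 / t ^+ 2]mulrA -[2 * theta / t]mulrA; lra.
Qed.


Let gauss_shift_mid t v : gauss_shift t v = normal_tail ((t - n%:R^-1 * v) / theta).
Proof. by congr normal_tail; field; rewrite !gt_eqF. Qed.

(** Given the block sum [v], the event bounds the Gaussian below by [(t - v / n) / theta]. Both
    kinds of endpoint are covered, because the complement of an open lower half-line is closed. *)
Lemma smoothed_mean_law b (t : R) :
  (P (smoothed_mean @^-1` [set` Interval (BSide b t) +oo%O]) =
   \int[P]_w (gauss_shift t (block_sum w))%:E)%E.
Proof.
pose I := [set` Interval (BSide b t) +oo%O].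
have mI : measurable I by exact: measurable_itv.
have mX := measurable_smoothed_mean.
pose h (z : R * R) := n%:R^-1 * z.1 + theta * z.2.
have mh : measurable_fun [set: R * R] h.
  by apply: measurable_funD; exact: measurable_funM.
have mf : measurable_fun [set: R * R] (fun z => (\1_I (h z))%:E : \bar R).
  apply/measurable_EFinP; apply: (measurableT_comp _ mh).
  exact: measurable_indic.
have f0 z : (0 <= (\1_I (h z) : R)%:E)%E by rewrite lee_fin.
have mXI : measurable (smoothed_mean @^-1` I).
  by rewrite -[_ @^-1` _]setTI; exact: mX.
rewrite -/I -[X in P X]setIT -integral_indic//.
have := independent_integral mS (mW ke)
  (independent_sum_pair mW Wind k0r_uniq ker) mf f0.
rewrite (_ : (fun w => _) = (fun w => (\1_(smoothed_mean @^-1` I) w)%:E)).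
  move=> ->; apply: eq_integral => w _ /=.
  pose z := (t - n%:R^-1 * block_sum w) / theta.
  pose J := [set` Interval (BSide b z) +oo%O].
  have mJ : measurable J by exact: measurable_itv.
  have mWJ : measurable (W ke @^-1` J) by rewrite -[_ @^-1` _]setTI; exact: mW.
  transitivity (\int[P]_w' (\1_(W ke @^-1` J) w')%:E)%E.
    apply: eq_integral => w' _; congr EFin; rewrite !indicE; congr (_%:R).
    congr nat_of_bool; apply/idP/idP; rewrite !inE /I /J /h /z /= !in_itv/= !andbT;
    by case: b {I mI mf f0 mXI J mJ mWJ} => /=;
      rewrite ?ler_pdivrMr ?ltr_pdivrMr// ?lerBlDl ?ltrBlDl (mulrC theta).
  rewrite integral_indic// setIT [LHS]Wgauss// gauss_shift_mid -/z /J.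
  by case: (b); [exact: normal_tail_cy|exact: normal_tailE].
by apply/funext => w; congr EFin; rewrite !indicE; congr (_%:R).
Qed.

(** The right side depends on [p], [n], [theta] and [t] only; this shows that all blocks have the
    same law. *)
Lemma smoothed_mean_iter b (t : R) :
  P (smoothed_mean @^-1` [set` Interval (BSide b t) +oo%O]) =
  iter n (averaging p) (EFin \o gauss_shift t) 0.
Proof.
rewrite smoothed_mean_law.
rewrite (@integral_independent_sum _ _ _ P _ W p mW Wind k0 r (EFin \o gauss_shift t))//.
- by apply/measurable_EFinP; exact: measurable_gauss_shift.
- by move=> x; rewrite lee_fin normal_tail_ge0.
Qed.

(** Under the symmetric law the mean of [g] is exactly 1, so the excess is at most the exchange
    error [n K M]. *)
Let expectation_sym_le (g : R -> R) : measurable_fun [set: R] g ->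
  (forall x, 0 <= g x) -> (forall x, g x + g (- x) = 2) ->
  quadratic_remainder (4 / (n%:R * theta) ^+ 2) g ->
  (\int[P]_w (g (block_sum w))%:E <= (1 + 4 * M / (theta ^+ 2 * n%:R))%:E)%E.
Proof.
move=> mg g0 gN gK.
have gb x : g x <= 2 by rewrite -(gN x) lerDl.
apply: (le_trans (expectation_block_sum_le _ mg g0 gb gK)).
  by rewrite divr_ge0// sqr_ge0.
have ms := measurable_even_part mp; have s0 := even_part_ge0 p0.
rewrite (@integral_convolution_pow _ _ ms s0 n (EFin \o g))//; last exact/measurable_EFinP.
rewrite iter_averaging_sym0//.
- rewrite -EFinD lee_fin lerD2l -mulr_natr le_eqVlt; apply/orP; left; apply/eqP.
  by field; rewrite !gt_eqF.
- exact: even_partN.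
- exact: integral_even_part.
- exact/measurable_EFinP.
- by move=> x; rewrite -EFinD gN.
Qed.

(** The mean of [g] is [1 + P(X > t) - P(X < - t)]. Applying the one-sided estimate to [g] and to
    [2 - g] bounds the difference from both sides. *)
Lemma smoothed_mean_sym (t : R) :
  `|fine (P (smoothed_mean @^-1` `]t, +oo[)) -
    fine (P (smoothed_mean @^-1` `]-oo, (- t)[))| <=
  4 * M / (theta ^+ 2 * n%:R).
Proof.
pose g v := gauss_shift t v + gauss_shift (- t) v.
have mX := measurable_smoothed_mean.
have gN x : g x + g (- x) = 2.
  rewrite /g /gauss_shift.
  set k := _^-1.
  have N1 := normal_tailN (- k * x + t / theta).
  have N2 := normal_tailN (- k * x + - t / theta).
  rewrite (_ : - k * - x + - t / theta = - (- k * x + t / theta)); last by ring.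
  rewrite (_ : - k * - x + t / theta = - (- k * x + - t / theta)); last by ring.
  lra.
have mg : measurable_fun [set: R] g.
  by apply: measurable_funD; exact: measurable_gauss_shift.
have g0 x : 0 <= g x by rewrite addr_ge0// normal_tail_ge0.
have gK : quadratic_remainder (4 / (n%:R * theta) ^+ 2) g.
  (* Two Gaussian tails with remainder constant 2, each with slope [1 / (n theta)] in absolute
     value. *)
  rewrite (_ : 4 / _ = 2 * (- (n%:R * theta)^-1) ^+ 2 + 2 * (- (n%:R * theta)^-1) ^+ 2).
    by apply: quadratic_remainderD; apply: quadratic_remainder_affine;
      exact: normal_tail_quadratic_remainder.
  by field; rewrite !gt_eqF.
have gK' : quadratic_remainder (4 / (n%:R * theta) ^+ 2) (fun v => 2 - g v).
  exact: quadratic_remainderB.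
have gb x : g x <= 2 by rewrite -(gN x) lerDl.
have mg' : measurable_fun [set: R] (fun v => 2 - g v) by exact: measurable_funB.
have g'0 x : 0 <= 2 - g x by rewrite subr_ge0.
have H1 := expectation_sym_le mg g0 gN gK.
have H2 : (\int[P]_w (2 - g (block_sum w))%:E <= (1 + 4 * M / (theta ^+ 2 * n%:R))%:E)%E.
  by apply: (expectation_sym_le mg' g'0 _ gK') => x; have := gN x; lra.
have mgS : measurable_fun [set: T] (fun w => (g (block_sum w))%:E).
  by apply/measurable_EFinP; exact: (measurableT_comp mg).
have mg'S : measurable_fun [set: T] (fun w => (2 - g (block_sum w))%:E).
  by apply/measurable_EFinP; exact: (measurableT_comp mg').
have sum2 : (\int[P]_w (g (block_sum w))%:E + \int[P]_w (2 - g (block_sum w))%:E = 2%:E)%E.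
  rewrite -ge0_integralD//=; last 2 first.
  - by move=> w _; rewrite lee_fin.
  - by move=> w _; rewrite lee_fin.
  under eq_integral do rewrite -EFinD addrC subrK.
  by rewrite integral_cst//= probability_setT mule1.
have E1 : (\int[P]_w (g (block_sum w))%:E =
    P (smoothed_mean @^-1` `]t, +oo[) + P (smoothed_mean @^-1` `[(- t)%R, +oo[))%E.
  rewrite (smoothed_mean_law false t) (smoothed_mean_law true (- t)).
  rewrite -ge0_integralD//=.
  - by move=> w _; rewrite lee_fin normal_tail_ge0.
  - by apply/measurable_EFinP; exact: (measurableT_comp (measurable_gauss_shift n theta _)).
  - by move=> w _; rewrite lee_fin normal_tail_ge0.
  - by apply/measurable_EFinP; exact: (measurableT_comp (measurable_gauss_shift n theta _)).
have mpre (A : set R) : measurable A -> measurable (smoothed_mean @^-1` A).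
  by move=> mA; rewrite -[_ @^-1` _]setTI; exact: mX.
have E2 : (P (smoothed_mean @^-1` `[(- t)%R, +oo[) =
    1 - P (smoothed_mean @^-1` `]-oo, (- t)%R[))%E.
  rewrite -probability_setC; last exact: mpre.
  by rewrite preimage_setC setCitvl.
have f1 : P (smoothed_mean @^-1` `]t, +oo[) \is a fin_num.
  by rewrite fin_num_measure//; exact: mpre.
have f2 : P (smoothed_mean @^-1` `]-oo, (- t)%R[) \is a fin_num.
  by rewrite fin_num_measure//; exact: mpre.
move: H1 H2 sum2; rewrite E1 E2.
case: (P (smoothed_mean @^-1` `]t, +oo[)) f1 => [x| |]// _.
case: (P (smoothed_mean @^-1` `]-oo, (- t)%R[)) f2 => [y| |]// _.
case: (\int[P]_w (2 - g (block_sum w))%:E)%E => [z| |]//.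
rewrite -!EFinN -!EFinD !lee_fin => xy zc [xyz] /=.
by rewrite ler_norml; apply/andP; split; lra.
Qed.

End block.

(** * The median of the block means *)

(** The quarter absorbs the factor [2 ^ (2 m + 1)] of the binomial bounds. *)
Lemma expr2_quarter (R : numFieldType) (x : R) m :
  2 ^+ (2 * m).+1 * (x / 4) ^+ m = 2 * x ^+ m.
Proof.
have e4 : 2 ^+ 2 = 4 :> R by rewrite expr2 -natrM.
rewrite exprS exprM e4 expr_div_n -mulrA; congr (_ * _).
by rewrite mulrCA divff ?mulr1// expf_neq0// pnatr_eq0.
Qed.

Section median.
Context d (T : measurableType d) (R : realType) (P : probability T R).
Local Notation mu := (@lebesgue_measure R).
Variables (m n' : nat).
Let n := n'.+1.
Let N := (2 * m).+1.
Let K := ('I_(N * n) + 'I_N)%type.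
Variables (Z V : nat -> T -> R).
Hypothesis mZ : forall i, measurable_fun [set: T] (Z i).
Hypothesis mV : forall i, measurable_fun [set: T] (V i).
Let W : K -> T -> R := smom_inputs (m := m) (n := n) Z V.
Hypothesis Wind : mutually_independent P W.
Variables (p : R -> R) (M B beta theta : R).
Hypothesis Zp : forall i, (i < N * n)%N -> has_density P (Z i) p.
Hypothesis Vgauss : forall j, (j < N)%N -> forall A, measurable A ->
  P (V j @^-1` A) = normal_prob 0 1 A.
Hypothesis int_ur : (\int[mu]_u (u * odd_part p u)%:E = 0)%E.
Hypothesis int_u2r :
  (\int[mu]_u (u ^+ 2 * `|odd_part p u|)%:E <= M%:E)%E.
Hypothesis B0 : 0 < B.
Hypothesis beta1 : 1 <= beta.
Hypothesis conv_le : forall v : R,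
  (convolution_pow (EFin \o even_part p) n v <=
   (B * n%:R / (n%:R `^ ((beta + 1) / beta) + `|v| `^ (1 + beta)))%:E)%E.
Hypothesis theta0 : 0 < theta.
Hypothesis M_le : 2 * M <= theta ^+ 2 * n%:R.
Hypothesis m3 : (3 <= m)%N.

Definition block_mean (j : nat) (w : T) : R :=
  n%:R^-1 * (\sum_(i < n) Z (j * n + i)%N w) + theta * V j w.

Definition block_median (w : T) : R :=
  nth 0 (sort <=%R [seq block_mean j w | j : 'I_N]) m.

Let mW k : measurable_fun [set: T] (W k).
Proof. by case: k => k; [exact: mZ|exact: mV]. Qed.

Let leaf_lt (j : 'I_N) (i : 'I_n) : (j * n + i < N * n)%N.
Proof.
apply: (@leq_trans (j.+1 * n)); first by rewrite mulSn addnC ltn_add2r.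
by rewrite leq_mul2r ltn_ord orbT.
Qed.

(** Index of sample [i] of block [j]. Sample [ord0] is the distinguished summand of the block;
    [leaves j] lists the others. *)
Let leaf j i : K := inl (Ordinal (leaf_lt j i)).

Let leaf_inj j : injective (leaf j).
Proof. by move=> i1 i2 [] /addnI /val_inj. Qed.

Let leaves j := [seq leaf j (lift ord0 i) | i : 'I_n'].

Let leaves_uniq j : uniq (leaf j ord0 :: leaves j).
Proof.
rewrite /= map_inj_uniq ?enum_uniq ?andbT.
  by apply/mapP => -[i _ /leaf_inj].
by move=> i1 i2 /leaf_inj /lift_inj.
Qed.

Let inr_leaves j : inr j \notin leaf j ord0 :: leaves j.
Proof. by rewrite inE /=; apply/mapP => -[]. Qed.

Let size_leaves j : size (leaves j) = n'.
Proof. by rewrite size_map size_enum_ord. Qed.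

Let block_meanE (j : 'I_N) :
  block_mean j = smoothed_mean W (leaf j ord0) (leaves j) (inr j) theta.
Proof.
apply/funext => w; rewrite /smoothed_mean /block_sum /block_mean size_leaves.
by rewrite big_ord_recl big_map big_enum.
Qed.

Lemma measurable_block_mean j : measurable_fun [set: T] (block_mean j).
Proof.
apply: measurable_funD; apply: measurable_funM => //.
exact: measurable_sum.
Qed.

(** Each sample is sent to the Gaussian of its block, so the index [inr j] ends up carrying the
    whole block mean. *)
Let block_of (k : K) : K :=
  match k with inl i => inr (inord (i %/ n)) | inr j => inr j end.

Let block_val (i : 'I_(N * n)) : (inord (i %/ n) : 'I_N) = (i %/ n)%N :> nat.
Proof. by rewrite inordK// ltn_divLR. Qed.

Lemma mutually_independent_block_mean :
  mutually_independent P (fun j : 'I_N => block_mean j).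
Proof.
(* Merging only adds, so the weights [1 / n] and [theta] are applied beforehand. *)
pose a (k : K) : R := if k is inl _ then n%:R^-1 else theta.
pose W1 k w := a k * W k w.
have mW1 k : measurable_fun [set: T] (W1 k) by exact: measurable_funM.
have W1ind : mutually_independent P W1.
  apply: (@mutually_independent_map _ _ _ P _ _ _ _ K W (fun k x => a k * x)) => // k.
  exact: measurable_funM.
pose r : seq K := [seq inl i | i : 'I_(N * n)].
have ur : uniq r by rewrite map_inj_uniq ?enum_uniq// => ? ? [].
have cr k : k \in r -> block_of k \notin r.
  by move=> /mapP[i _ ->]; apply/mapP => -[].
have Mind := mutually_independent_merge_seq mW1 cr W1ind.
have E (j : 'I_N) : merge_seq block_of W1 r (inr j) = block_mean j.
  apply/funext => w; rewrite merge_seqE//.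
  rewrite (_ : inr j \in r = false); last by apply/mapP => -[].
  rewrite /block_mean addrC; congr (_ + _).
  rewrite big_map big_enum_cond/= mulr_sumr.
  rewrite -(sum_block n j (fun i => n%:R^-1 * Z i w)).
  apply: eq_bigl => i /=; apply/eqP/eqP => [[<-]|ij]; first by rewrite block_val.
  by congr inr; apply: val_inj; rewrite /= block_val.
move=> A mA.
pose A' (k : K) : set R := if k is inr j then A j else setT.
have mA' k : measurable (A' k) by case: k => k; [exact: measurableT|exact: mA].
have := Mind A' mA'; rewrite big_sumType /= big1 ?mul1e; last first.
  by move=> i _; rewrite preimage_setT probability_setT.
under eq_bigr do rewrite E.
move=> <-; congr (P _); apply/seteqP; split => w /= Aw.
  by case=> // j; rewrite E; exact: Aw.
by move=> j; have := Aw (inr j); rewrite E.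
Qed.

Let conv_le' j v : (convolution_pow (EFin \o even_part p) (size (leaves j)).+1 v <=
   (B * (size (leaves j)).+1%:R / ((size (leaves j)).+1%:R `^ ((beta + 1) / beta) +
     `|v| `^ (1 + beta)))%:E)%E.
Proof. by rewrite size_leaves. Qed.

Let M_le' j : 2 * M <= theta ^+ 2 * (size (leaves j)).+1%:R.
Proof. by rewrite size_leaves. Qed.

Let Zp' j : {in leaf j ord0 :: leaves j, forall k, has_density P (W k) p}.
Proof.
move=> k; rewrite inE => /predU1P[->|/mapP[i _ ->]]; exact/Zp/leaf_lt.
Qed.

Let Vgauss' (j : 'I_N) A : measurable A -> P (W (inr j) @^-1` A) = normal_prob 0 1 A.
Proof. by move=> mA; exact/Vgauss. Qed.

(** Block 0 represents all blocks, which have the same law. *)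
Let upper t := fine (P (block_mean 0 @^-1` `]t, +oo[)).
Let lower t := fine (P (block_mean 0 @^-1` `]-oo, (- t)[)).

Let mpre j (A : set R) : measurable A -> measurable (block_mean j @^-1` A).
Proof. by move=> mA; rewrite -[_ @^-1` _]setTI; exact: measurable_block_mean. Qed.

Let law_itv (j : 'I_N) b t :
  P (block_mean j @^-1` [set` Interval (BSide b t) +oo%O]) =
  P (block_mean 0 @^-1` [set` Interval (BSide b t) +oo%O]).
Proof.
have law (i : 'I_N) : P (block_mean i @^-1` [set` Interval (BSide b t) +oo%O]) =
    iter n (averaging p) (EFin \o gauss_shift n theta t) 0.
  by rewrite block_meanE (smoothed_mean_iter mW Wind (leaves_uniq i) (inr_leaves i)
    (@Zp' i) (@Vgauss' i) theta0) size_leaves.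
by rewrite law; exact/esym/(law ord0).
Qed.

Let law_upper (j : 'I_N) t : P (block_mean j @^-1` `]t, +oo[) = (upper t)%:E.
Proof. by rewrite law_itv fineK// fin_num_measure//; exact: mpre. Qed.

Let law_lower (j : 'I_N) t : P (block_mean j @^-1` `]-oo, (- t)[) = (lower t)%:E.
Proof.
rewrite /lower fineK; last by rewrite fin_num_measure//; exact: mpre.
rewrite -setCitvr -!preimage_setC !probability_setC; try exact: mpre.
by rewrite law_itv.
Qed.

Let count_law (A : set R) (q : R) (mA : measurable A) :
  (forall j : 'I_N, P (block_mean j @^-1` A) = q%:E) ->
  P [set w | (m < count (fun j : 'I_N => block_mean j w \in A) (enum 'I_N))%N] =
    (binomial_tail N m.+1 q)%:E /\
  measurable [set w | (m < count (fun j : 'I_N => block_mean j w \in A) (enum 'I_N))%N].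
Proof.
move=> Aq.
have q01 : 0 <= q <= 1.
  rewrite -!lee_fin -(Aq ord0) measure_ge0 probability_le1//; exact: mpre.
have := @probability_count_ge _ T R P 'I_N (fun j : 'I_N => block_mean j) A q
  measurable_block_mean mA q01 (enum 'I_N) m.+1 setT measurableT (enum_uniq 'I_N).
move=> /(_ (fun j _ => Aq j)).
rewrite !setTI probability_setT size_enum_ord mul1e; apply => C mC.
rewrite setTI mul1e big_enum -(mutually_independent_block_mean mC).
congr (P _); apply/seteqP; split => w /= Cw i; first by apply: Cw; rewrite mem_enum.
by move=> _; exact: Cw.
Qed.

Let size_block_means w : size [seq block_mean j w | j : 'I_N] = N.
Proof. by rewrite size_map size_enum_ord. Qed.

Let count_block_means w (Q : pred R) :
  count Q [seq block_mean j w | j : 'I_N] =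
  count (fun j : 'I_N => Q (block_mean j w)) (enum 'I_N).
Proof. exact: count_map. Qed.

Let median_upper t :
  P [set w | t < block_median w] = (binomial_tail N m.+1 (upper t))%:E /\
  measurable [set w | t < block_median w].
Proof.
have <- : [set w | (m < count (fun j : 'I_N => block_mean j w \in `]t, +oo[%classic)
    (enum 'I_N))%N] = [set w | t < block_median w].
  apply/funext => w /=; rewrite lt_nth_sort// count_block_means; congr (is_true (_ < _)%N).
  by apply: eq_count => j /=; apply/idP/idP; rewrite inE/= in_itv/= andbT.
by apply: count_law => // j; exact: law_upper.
Qed.

Let median_lower t :
  P [set w | block_median w < - t] = (binomial_tail N m.+1 (lower t))%:E.
Proof.
have <- : [set w | (m < count (fun j : 'I_N => block_mean j w \in `]-oo, (- t)[%classic)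
    (enum 'I_N))%N] = [set w | block_median w < - t].
  apply/funext => w /=; rewrite nth_sort_lt// count_block_means; congr (is_true (_ < _)%N).
  by apply: eq_count => j /=; apply/idP/idP; rewrite inE/= in_itv/=.
by apply: (@count_law _ _ _ _).1 => // j; exact: law_lower.
Qed.

Lemma measurable_block_median : measurable_fun [set: T] block_median.
Proof.
move=> _; apply: (measurability _ (RGenOInfty.measurableE R)) => // _ [_ [t ->] <-].
rewrite setTI (_ : _ @^-1` _ = [set w | t < block_median w]).
  by have [] := median_upper t.
by apply/seteqP; split => w /=; rewrite in_itv/= andbT.
Qed.

(** 432 is 4 * 108: the tail of one block is at most a quarter of [median_scale / t]. *)
Definition median_scale : R := 432 * (tail_scale n B beta + theta).

Let prob_bound j (A : set R) : measurable A -> 0 <= fine (P (block_mean j @^-1` A)) <= 1.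
Proof.
move=> mA; have := mpre j mA => mjA.
rewrite fine_ge0//= -lee_fin fineK ?fin_num_measure//; exact: probability_le1.
Qed.

Let tail_le t : 0 < t -> upper t <= median_scale / (4 * t) /\ lower t <= median_scale / (4 * t).
Proof.
move=> t0.
have := @smoothed_mean_tail _ _ _ P K W p mW Wind (leaf ord0 ord0) (leaves ord0)
  (inr ord0) (leaves_uniq ord0) (@Zp' ord0) (@Vgauss' ord0) M B beta theta
  int_ur int_u2r B0 beta1 (@conv_le' ord0) theta0 (@M_le' ord0) t t0.
rewrite size_leaves -(block_meanE ord0) => tl.
have half : 108 * (tail_scale n B beta + theta) / t = median_scale / (4 * t).
  by rewrite /median_scale; field; rewrite gt_eqF.
have mE : measurable [set w | t < `|block_mean 0 w|].
  rewrite (_ : [set w | _] = (fun w => `|block_mean 0 w|) @^-1` `]t, +oo[%classic).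
    rewrite -[_ @^-1` _]setTI.
    exact: (measurableT_comp (@normr_measurable R setT) (measurable_block_mean 0)).
  by apply/seteqP; split => w /=; rewrite in_itv/= andbT.
rewrite -half; split; rewrite -lee_fin fineK; try by rewrite fin_num_measure//; exact: mpre.
  apply: le_trans tl; rewrite le_measure ?inE//; first exact: mpre.
  by move=> w /=; rewrite in_itv/= andbT ltr_normr => ->.
apply: le_trans tl; rewrite le_measure ?inE//; first exact: mpre.
by move=> w /=; rewrite in_itv/= ltr_normr ltrNr => ->; rewrite orbT.
Qed.

Let diff_le t : `|upper t - lower t| <= 4 * M / (theta ^+ 2 * n%:R).
Proof.
have := @smoothed_mean_sym _ _ _ P K W p mW Wind (leaf ord0 ord0) (leaves ord0)
  (inr ord0) (leaves_uniq ord0) (inr_leaves ord0) (@Zp' ord0) (@Vgauss' ord0)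
  M theta int_ur int_u2r theta0 t.
by rewrite size_leaves -(block_meanE ord0).
Qed.

Let scale_gt0 : 0 < median_scale.
Proof.
have D0 : 0 < tail_scale n B beta.
  by apply: tail_scale_gt0 => //; exact: lt_le_trans beta1.
by rewrite /median_scale; apply: mulr_gt0; [rewrite ltr0n|exact: addr_gt0].
Qed.

(** With [x = median_scale / t], each side contributes [2 ^ N (x / 4) ^ (m + 1) = x ^ (m + 1) / 2],
    and [m >= 3] makes it at most [x ^ 4 / 2]. *)
Let median_tail t : median_scale <= t ->
  (P [set w | (t < `|block_median w|)%R] <= ((median_scale / t) ^+ 4)%:E)%E.
Proof.
move=> st; have t0 := lt_le_trans scale_gt0 st.
have [ut lt] := tail_le t0.
have [Pu mu'] := median_upper t; have Pl := median_lower t.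
have u01 : 0 <= upper t <= 1 by apply: prob_bound.
have l01 : 0 <= lower t <= 1 by apply: prob_bound.
have mY := measurable_block_median.
have ml : measurable [set w | block_median w < - t].
  rewrite (_ : [set w | _] = block_median @^-1` `]-oo, (- t)[%classic).
    by rewrite -[_ @^-1` _]setTI; exact: mY.
  by apply/seteqP; split => w /=; rewrite in_itv.
rewrite (_ : [set w | _] = [set w | t < block_median w] `|` [set w | block_median w < - t]).
  apply: (le_trans (measureU2 P mu' ml)).
  rewrite [X in (X + _ <= _)%E]Pu [X in (_ + X <= _)%E]Pl -EFinD lee_fin.
  set x := median_scale / t.
  have x01 : 0 <= x <= 1 by rewrite /x ler_pdivrMr// mul1r st divr_ge0 ?ltW.
  have q4 : median_scale / (4 * t) = x / 4 by rewrite /x; field; rewrite gt_eqF.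
  rewrite q4 in ut lt.
  have H q : 0 <= q <= 1 -> q <= x / 4 -> binomial_tail N m.+1 q <= x ^+ 4 / 2.
    move=> /andP[q0 q1] qx; apply: (le_trans (binomial_tail_le _ _ _)); first by rewrite q0.
    apply: (@le_trans _ _ (2 ^+ N * (x / 4) ^+ m.+1)).
      rewrite ler_wpM2l ?exprn_ge0//; case/andP: x01 => x0 _.
      by apply: lerXn2r => //; rewrite nnegrE divr_ge0.
    have -> : 2 ^+ N * (x / 4) ^+ m.+1 = x ^+ m.+1 / 2 :> R.
      by rewrite exprSr mulrA expr2_quarter exprSr; field.
    rewrite ler_pM2r ?invr_gt0//; case/andP: x01 => x0 x1.
    by apply: ler_wiXn2l.
  have := H _ u01 ut; have := H _ l01 lt; lra.
by apply/seteqP; split => w /=; rewrite ltr_normr ltrNr => /orP.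
Qed.

Let k0 : R := 2 * N%:R * (4 * M / (theta ^+ 2 * n%:R)).

(** Below the scale the Lipschitz bound suffices. Above it the refined bound supplies [2 x ^ m],
    which explains the 2 in [k0], and [m >= 2] gives the integrable [x ^ 2]. *)
Let tail_diff t : 0 <= t ->
  `|binomial_tail N m.+1 (upper t) - binomial_tail N m.+1 (lower t)| <=
  k0 * inv_sqr_tail median_scale t.
Proof.
move=> t0; have u01 : 0 <= upper t <= 1 by apply: prob_bound.
have l01 : 0 <= lower t <= 1 by apply: prob_bound.
have dl := diff_le t.
set c := 4 * M / _ in dl *; have c0 : 0 <= c by exact: le_trans dl.
rewrite /inv_sqr_tail /k0 -/c; case: ltP => [_|st].
  apply: (le_trans (binomial_tail_lipschitz _ _ u01 l01)).
  rewrite mulr1 -mulrA mulrCA ler_wpM2l//.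
  by apply: (le_trans dl); lra.
have {t0}t0 := lt_le_trans scale_gt0 st.
have [ut lt] := tail_le t0.
set x := median_scale / t.
have x01 : 0 <= x <= 1 by rewrite /x ler_pdivrMr// mul1r st divr_ge0 ?ltW.
have q4 : median_scale / (4 * t) = x / 4 by rewrite /x; field; rewrite gt_eqF.
rewrite q4 in ut lt.
case/andP: x01 => x0 x1; case/andP: u01 => u0 u1; case/andP: l01 => l0 l1.
have ux : 0 <= upper t <= x / 4 by rewrite u0.
have lx : 0 <= lower t <= x / 4 by rewrite l0.
have x4 : x / 4 <= 1 by lra.
apply: (le_trans (binomial_tail_diff_le _ _ ux lx x4)).
have -> : median_scale ^+ 2 * t `^ (- (1 + 1)) = x ^+ 2.
  by rewrite powRN (_ : (1 + 1 = 2%:R)%R)// powR_mulrn ?(ltW t0)// /x expr_div_n.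
have -> : N%:R * 2 ^+ N * (x / 4) ^+ m = 2 * N%:R * x ^+ m :> R.
  by rewrite -mulrA expr2_quarter mulrCA mulrA.
rewrite -!(mulrA (2 * N%:R)) ler_wpM2l// [leRHS]mulrC.
apply: ler_pM => //; first exact: exprn_ge0.
by apply: ler_wiXn2l => //; exact: ltnW.
Qed.

Lemma block_median_moments :
  [/\ (\int[P]_w ((block_median w) ^+ 2)%:E <= (2 * median_scale ^+ 2)%:E)%E,
    P.-integrable [set: T] (EFin \o block_median) &
    `|fine (\int[P]_w (block_median w)%:E)| <=
    2 * N%:R * (4 * M / (theta ^+ 2 * n%:R)) * (2 * median_scale)].
Proof.
have mY := measurable_block_median.
have E2 := second_moment_le mY scale_gt0 median_tail.
have iY : P.-integrable [set: T] (EFin \o block_median).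
  (* The majorant comes from [|y| <= 1 + y^2]. *)
  apply: (@le_integrable _ _ _ P _ measurableT _
    (fun w => (1 + block_median w ^+ 2)%:E)).
  - exact/measurable_EFinP.
  - move=> w _ /=; rewrite lee_fin [leRHS]ger0_norm ?addr_ge0 ?sqr_ge0//.
    have := sqr_ge0 (`|block_median w| - 1); rewrite sqrrB1 real_normK ?num_real//.
    by have := normr_ge0 (block_median w); lra.
  - apply/integrableP; split.
      have mY2 := measurable_funX 2 mY.
      by apply/measurable_EFinP; exact: measurable_funD.
    apply: (@le_lt_trans _ _ (\int[P]_w (1 + ((block_median w) ^+ 2)%:E))%E).
      apply: ge0_le_integral => //.
      - apply: measurableT_comp => //; apply/measurable_EFinP.
        by apply: measurable_funD => //; exact: measurable_funX.
      - apply: emeasurable_funD => //; apply/measurable_EFinP; exact: measurable_funX.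
      - by move=> w _ /=; rewrite ger0_norm ?EFinD ?addr_ge0 ?sqr_ge0.
    rewrite ge0_integralD//=.
    + rewrite integral_cst//= probability_setT mul1e.
      by rewrite lte_add_pinfty ?ltry// (le_lt_trans E2) ?ltry.
    + by move=> w _; rewrite lee_fin sqr_ge0.
    + by apply/measurable_EFinP; exact: measurable_funX.
split => //.
apply: (expectation_le mY scale_gt0 _ iY).
- apply: mulr_ge0; first exact: mulr_ge0.
  exact: le_trans (diff_le 0).
- move=> t t0; have [-> _] := median_upper t; rewrite median_lower -EFinD lee_fin.
  by have := tail_diff t0; rewrite /k0 ler_norml => /andP[_]; lra.
- move=> t t0; have [-> _] := median_upper t; rewrite median_lower -EFinD lee_fin.
  by have := tail_diff t0; rewrite /k0 ler_norml => /andP[+ _]; lra.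
Qed.

End median.

(** * Coordinates *)

Lemma measurable_coord (R : realType) d (j : 'I_d) :
  measurable_fun [set: 'rV[R]_d] (fun v : 'rV[R]_d => v ord0 j).
Proof.
move=> _ A mA; rewrite setTI; apply: sub_sigma_algebra => /=.
rewrite -bigcup_seq/=; exists j => /=; first by rewrite mem_index_enum.
by exists A => //; rewrite setTI.
Qed.

Section component.
Context (d : nat) dO (Omega : measurableType dO) (R : realType)
  (P : probability Omega R).
Variables (m n' : nat) (theta : R) (zeta eta : nat -> {RV P >-> 'rV[R]_d}).
Variables (j : 'I_d) (c : R).
Let n := n'.+1.

Definition centered_coord i w := zeta i w ord0 j - c.
Definition noise_coord i w := eta i w ord0 j.

Lemma measurable_rV_coord (X : {RV P >-> 'rV[R]_d}) :
  measurable_fun [set: Omega] (fun w => X w ord0 j).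
Proof.
exact: (measurableT_comp (@measurable_coord R d j) (measurable_funPT X)).
Qed.

Lemma measurable_centered_coord i : measurable_fun [set: Omega] (centered_coord i).
Proof. by apply: measurable_funB => //; exact: measurable_rV_coord. Qed.

Lemma mutually_independent_coord :
  mutually_independent P (smom_inputs (m := m) (n := n)
    (fun i => zeta i : Omega -> 'rV[R]_d) (fun i => eta i : Omega -> 'rV[R]_d)) ->
  mutually_independent P
    (smom_inputs (m := m) (n := n) centered_coord noise_coord).
Proof.
pose g (k : 'I_((2 * m).+1 * n) + 'I_(2 * m).+1) (v : 'rV[R]_d) : R :=
  if k is inl _ then v ord0 j - c else v ord0 j.
have mg k : measurable_fun [set: 'rV[R]_d] (g k).
  case: k => k; last exact: measurable_coord.
  by apply: measurable_funB => //; exact: measurable_coord.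
move=> /(mutually_independent_map mg).
rewrite (_ : (fun k w => _) = smom_inputs (m := m) (n := n) centered_coord noise_coord)//.
by apply/funext => -[].
Qed.

(** Subtracting a constant preserves the order, so it commutes with sorting and with taking a
    median. *)
Lemma smom_coord w :
  smom m n theta (fun i => zeta i : Omega -> 'rV[R]_d)
    (fun i => eta i : Omega -> 'rV[R]_d) w ord0 j - c =
  block_median m n' centered_coord noise_coord theta w.
Proof.
rewrite /smom /med mxE /block_median.
set s := [seq _ | i : 'I__].
have -> : [seq block_mean n' centered_coord noise_coord theta i w | i : 'I_(2 * m).+1]
    = [seq x - c | x <- s].
  rewrite /s -[RHS]map_comp; apply: eq_map => i /=.
  rewrite /block_mean /centered_coord /noise_coord !mxE summxE.
  rewrite big_split/= sumrN sumr_const card_ord mulrBr -(mulr_natl c).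
  by rewrite mulKf ?pnatr_eq0// addrAC.
have : size s = (2 * m).+1 by rewrite size_map size_enum_ord.
move: s => s sz; rewrite sort_map (nth_map 0); last by rewrite size_sort sz; lia.
congr (nth _ (sort _ _) _ - _).
by apply/funext => x; apply/funext => y; rewrite /= lerD2r.
Qed.

End component.

Lemma standard_gaussian_coord dO (Omega : measurableType dO) (R : realType)
    (P : probability Omega R) d (X : Omega -> 'rV[R]_d) (j : 'I_d) (A : set R) :
  standard_gaussian P X -> measurable A ->
  P ((fun w => X w ord0 j) @^-1` A) = normal_prob 0 1 A.
Proof.
move=> XN mA; pose B k : set R := if k == j then A else setT.
have mB k : measurable (B k) by rewrite /B; case: ifP.
have := XN B mB; rewrite (bigD1 j)//= {2}/B eqxx big1 ?mule1; last first.
  by move=> k kj; rewrite /B (negbTE kj) probability_setT.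
move=> <-; congr (P _); apply/seteqP; split => w /=.
  by move=> Aw k; rewrite /B; case: eqP => // ->.
by move=> /(_ j); rewrite /B eqxx.
Qed.

(** * From coordinates to the Euclidean norm *)

Lemma norm2_sqr (R : realType) d (v : 'rV[R]_d) :
  norm2 v ^+ 2 = \sum_(j < d) v ord0 j ^+ 2.
Proof. by rewrite /norm2 sqr_sqrtr// sumr_ge0// => j _; exact: sqr_ge0. Qed.

(** The square of a sum of two terms is at most twice the sum of their squares; summing over [j] and
    returning to the norm costs the factor 2. *)
Lemma sqrt_sum_sqr_le (R : realType) d (v : 'rV[R]_d) (a b : 'I_d -> R) (x y z : R) :
  0 <= x -> 0 <= y -> 0 <= z ->
  (forall j, 0 <= b j) ->
  (forall j, `|v ord0 j| <= z * (x * a j + y * (a j * b j))) ->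
  norm2 v <= 2 * z * (x * Num.sqrt (\sum_(j < d) a j ^+ 2) +
    y * Num.sqrt (\sum_(j < d) a j ^+ 2 * b j ^+ 2)).
Proof.
move=> x0 y0 z0 b0 vab.
set A := \sum_(j < d) a j ^+ 2; set B := \sum_(j < d) a j ^+ 2 * b j ^+ 2.
have A0 : 0 <= A by apply: sumr_ge0 => j _; exact: sqr_ge0.
have B0 : 0 <= B by apply: sumr_ge0 => j _; rewrite mulr_ge0 ?sqr_ge0.
have [sA sB] := (sqrtr_ge0 A, sqrtr_ge0 B).
have rhs0 : 0 <= 2 * z * (x * Num.sqrt A + y * Num.sqrt B).
  by rewrite mulr_ge0 ?addr_ge0 ?mulr_ge0.
rewrite -(ler_pXn2r (n := 2)) ?nnegrE ?sqrtr_ge0// norm2_sqr.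
apply: (@le_trans _ _ (\sum_(j < d) z ^+ 2 *
    (2 * x ^+ 2 * a j ^+ 2 + 2 * y ^+ 2 * (a j ^+ 2 * b j ^+ 2)))).
  apply: ler_sum => j _.
  rewrite -real_normK ?num_real//.
  apply: (@le_trans _ _ ((z * (x * a j + y * (a j * b j))) ^+ 2)).
    rewrite lerXn2r ?nnegrE//; exact: le_trans (vab j).
  rewrite exprMn ler_wpM2l ?sqr_ge0//.
  have := sqr_ge0 (x * a j - y * (a j * b j)).
  move: (a j) (b j) => s t; lra.
rewrite -mulr_sumr big_split/= -!mulr_sumr -/A -/B.
rewrite -{1}(sqr_sqrtr A0) -{1}(sqr_sqrtr B0).
move: (Num.sqrt A) (Num.sqrt B) sA sB => s t s0 t0.
rewrite [leRHS](_ : _ = z ^+ 2 * (4 * (x * s + y * t) ^+ 2)); last by ring.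
rewrite ler_wpM2l ?sqr_ge0//.
have : 0 <= (x * s) * (y * t) by rewrite !mulr_ge0.
have := sqr_ge0 (x * s); have := sqr_ge0 (y * t); lra.
Qed.

Lemma sqr_scaleD_le (R : realDomainType) (l a b : R) :
  2 * (l * (a + b)) ^+ 2 <= 4 * l ^+ 2 * (b ^+ 2 + a ^+ 2).
Proof. by have := mulr_ge0 (sqr_ge0 l) (sqr_ge0 (a - b)); lra. Qed.

(** Used with [N = 2 m + 1 <= 3 m] and [k = m]: then [16 N <= 48 m], and this is where [24 <= l]
    comes from. *)
Lemma bias_constant_le (R : realFieldType) (l a b t k N : R) :
  24 <= l -> 0 < a <= b -> 0 < t -> 0 <= k -> 0 <= N <= 3 * k ->
  16 * N * (a + t) <= 2 * l * k * (1 + t + b).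
Proof.
move=> l24 /andP[a0 ab] t0 k0 /andP[N0 Nk].
apply: ler_pM; [lra|lra| |lra].
have : 48 * k <= 2 * l * k by rewrite ler_wpM2r//; lra.
lra.
Qed.

Theorem lemma4p5 (R : realType) :
  exists C : R, 0 < C /\
  forall (d : nat) (f : 'rV[R]_d -> R)
    (dXi : measure_display) (Xi : measurableType dXi) (Q : probability Xi R)
    (Gf : 'rV[R]_d -> {RV Q >-> 'rV[R]_d})
    (p : 'rV[R]_d -> 'I_d -> R -> R) (M B beta : 'I_d -> R)
    (theta : R) (m n : nat),
  (forall x, differentiable f x) ->
  (forall x, distribution Q (Gf x) `<< @lebesgue_rV R d) ->
  (forall x j, has_density Q
     (fun xi => (Gf x xi - gradient f x) ord0 j) (p x j)) ->
  (forall j, 0 < M j) ->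
  (forall x j,
     (\int[lebesgue_measure]_u (u * odd_part (p x j) u)%:E)%E = 0%E /\
     (\int[lebesgue_measure]_u (u ^+ 2 * `|odd_part (p x j) u|)%:E
        <= (M j)%:E)%E) ->
  (forall j, 0 < B j /\ 1 <= beta j) ->
  (forall x j (k : nat) (u : R), (0 < k)%N ->
     (convolution_pow (EFin \o even_part (p x j)) k u <=
      (B j * k%:R /
        (k%:R `^ ((beta j + 1) / beta j) + `|u| `^ (1 + beta j)))%:E)%E) ->
  0 < theta -> (0 < m)%N -> (0 < n)%N ->
  (forall j, 2 + 3 / beta j < m%:R) ->
  (forall j, Num.max 2 (m%:R ^+ 2) * M j <= theta ^+ 2 * n%:R) ->
  forall (x : 'rV[R]_d)
    (dO : measure_display) (Omega : measurableType dO)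
    (P : probability Omega R)
    (zeta eta : nat -> {RV P >-> 'rV[R]_d}),
  (forall i, (i < (2 * m).+1 * n)%N ->
     forall A, measurable A ->
       distribution P (zeta i) A = distribution Q (Gf x) A) ->
  (forall j, (j < (2 * m).+1)%N -> standard_gaussian P (eta j)) ->
  mutually_independent P
    (smom_inputs (m := m) (n := n)
       (fun i => zeta i : Omega -> 'rV[R]_d)
       (fun j => eta j : Omega -> 'rV[R]_d)) ->
  let S : Omega -> 'rV[R]_d := smom m n theta
    (fun i => zeta i : Omega -> 'rV[R]_d)
    (fun j => eta j : Omega -> 'rV[R]_d) in
  ('E_P[fun w => (norm2 (S w - gradient f x) ^+ 2)%R] <=
    (C * (m%:R * ((1 + theta ^+ 2) * d%:R +
      \sum_(j < d)
        ((M j / (theta * n%:R)) ^+ 2 +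
         (2 `^ beta j * B j / (beta j * n%:R `^ (beta j - 1)))
           `^ (2 / beta j) +
         (B j * M j / (theta * n%:R `^ beta j))
           `^ (2 / (beta j + 1))))))%:E)%E /\
  norm2 (vexpectation P S - gradient f x) <=
    C * (m%:R * (1 + theta) / (theta ^+ 2 * n%:R) *
           Num.sqrt (\sum_(j < d) M j ^+ 2) +
         m%:R / (theta ^+ 2 * n%:R) *
           Num.sqrt (\sum_(j < d) M j ^+ 2 *
             (2 `^ beta j * B j / n%:R `^ (beta j - 1)) `^ (2 / beta j))).
Proof.
(* The factor of [median_scale]; the bias estimate needs only that it is at least 24. *)
have [L LE L24] : exists2 L : R, L = 432 & 24 <= L.
  by exists 432 => //; rewrite ler_nat.
have L0 : 0 < L by lra.
(* Serves both bounds: [2 (L (D + theta))^2 <= 4 L^2 (theta^2 + D^2)] for the second moment, and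
   [2 L^2] per coordinate, doubled by the passage to the norm, for the bias. *)
exists (4 * L ^+ 2); split; first by rewrite mulr_gt0// exprn_gt0.
move=> d f dXi Xi Q Gf p M B beta theta m n _ _ Gp M0 pr Bb pconv theta0 m0 n0
  m_gt M_le x dO Omega P zeta eta zlaw etaN ind S.
case: n n0 M_le zlaw ind @S => // n' _ M_le zlaw ind S; set n := n'.+1 in M_le zlaw ind S *.
have n0 : 0 < n%:R :> R by rewrite ltr0n.
pose G := gradient f x.
pose Y (j : 'I_d) : Omega -> R :=
  block_median m n' (centered_coord zeta j (G ord0 j)) (noise_coord eta j) theta.
pose D j := tail_scale n (B j) (beta j).
have SY w (j : 'I_d) : (S w - G) ord0 j = Y j w.
  by rewrite mxE [(- G) _ _]mxE; exact: smom_coord.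
have B0 j : 0 < B j by have [] := Bb j.
have beta1 j : 1 <= beta j by have [] := Bb j.
have beta0 j : 0 < beta j by exact: lt_le_trans (beta1 j).
have D0 j : 0 < D j by exact: tail_scale_gt0.
have mZ j i : measurable_fun [set: Omega] (centered_coord zeta j (G ord0 j) i).
  exact: measurable_centered_coord.
have mV j i : measurable_fun [set: Omega] (noise_coord eta j i).
  exact: measurable_rV_coord.
(* [3 / beta j] is nonnegative, so the integer [m] exceeds 2. A coordinate [j] is required, since in
   dimension 0 the hypothesis says nothing. *)
have m3 (j : 'I_d) : (3 <= m)%N.
  rewrite -(ltr_nat R); apply: le_lt_trans (m_gt j).
  by rewrite lerDl divr_ge0// ltW.
have M2 j : 2 * M j <= theta ^+ 2 * n%:R.
  by apply: le_trans (M_le j); rewrite ler_wpM2r ?(ltW (M0 j))// le_max lexx.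
have Zp j i : (i < (2 * m).+1 * n)%N ->
    has_density P (centered_coord zeta j (G ord0 j) i) (p x j).
  move=> iN; have [mp p0 pA] := Gp x j; split => // A mA; rewrite -pA//.
  have mA' : measurable [set v : 'rV[R]_d | A (v ord0 j - G ord0 j)].
    rewrite -[X in measurable X]setTI.
    apply: (measurable_funB (@measurable_coord R d j) (measurable_cst _)) => //.
  have := zlaw i iN _ mA'; rewrite /distribution/= /pushforward => E.
  transitivity (P (zeta i @^-1` [set v : 'rV[R]_d | A (v ord0 j - G ord0 j)])) => //.
  rewrite E; congr (Q _); apply/seteqP; split => w /=; by rewrite !mxE.
have VN j i : (i < (2 * m).+1)%N -> forall A, measurable A ->
    P (noise_coord eta j i @^-1` A) = normal_prob 0 1 A.
  by move=> iN A mA; exact: (standard_gaussian_coord j (etaN i iN) mA).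
have mom j := @block_median_moments _ Omega R P m n' _ _ (mZ j) (mV j)
  (mutually_independent_coord j (G ord0 j) ind)
  (p x j) (M j) (B j) (beta j) theta (Zp j) (VN j) (pr x j).1 (pr x j).2 (B0 j)
  (beta1 j) (fun v => pconv x j n v isT) theta0 (M2 j) (m3 j).
have mY j : measurable_fun [set: Omega] (Y j).
  exact: (@measurable_block_median _ Omega R P m n' _ _ (mZ j) (mV j)
  (mutually_independent_coord j (G ord0 j) ind)
  (p x j) theta (Zp j) (VN j) theta0).
have sqr_root (a b : R) : (a `^ (1 / b)) ^+ 2 = a `^ (2 / b).
  by rewrite -powR_mulrn ?powR_ge0// -powRrM mulrAC mul1r.
pose T j := L * (D j + theta).
have T0 j : 0 < T j by rewrite mulr_gt0// addr_gt0.
split.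
  rewrite unlock.
  have -> : (\int[P]_w ((norm2 (S w - G)) ^+ 2)%:E =
      \sum_(j < d) \int[P]_w ((Y j w) ^+ 2)%:E)%E.
    rewrite -ge0_integral_sum//.
    - apply: eq_integral => w _; rewrite norm2_sqr sumEFin; congr EFin.
      by apply: eq_bigr => j _; rewrite SY.
    - by move=> j; apply/measurable_EFinP; exact: measurable_funX.
    - by move=> j w _; rewrite lee_fin sqr_ge0.
  apply: (@le_trans _ _ (\sum_(j < d) (2 * T j ^+ 2)%:E)%E).
    by apply: lee_sum => j _; have [+ _ _] := mom j; rewrite /median_scale -LE.
  rewrite sumEFin lee_fin.
  apply: (@le_trans _ _ (\sum_(j < d) 4 * L ^+ 2 * (theta ^+ 2 + D j ^+ 2))).
    by apply: ler_sum => j _; exact: sqr_scaleD_le.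
  rewrite -mulr_sumr ler_wpM2l//; first by rewrite mulr_ge0// sqr_ge0.
  rewrite -[leLHS]mul1r; apply: ler_pM => //.
  - by apply: sumr_ge0 => j _; rewrite addr_ge0 ?sqr_ge0.
  - by rewrite ler1n.
  rewrite big_split/= sumr_const card_ord -(mulr_natr (theta ^+ 2)); apply: lerD.
    by rewrite ler_wpM2r// lerDr.
  apply: ler_sum => j _; rewrite -sqr_root.
  rewrite -[leLHS]addr0; apply: lerD; last exact: powR_ge0.
  by rewrite lerDr sqr_ge0.
(* The scale of the bias bound has no [beta] in the denominator; it dominates [D] because
   [1 <= beta]. *)
pose D' j := (2 `^ beta j * B j / n%:R `^ (beta j - 1)) `^ (1 / beta j).
have DD' j : D j <= D' j.
  rewrite ge0_ler_powR ?nnegrE//.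
  - by rewrite divr_ge0// ltW.
  - by rewrite divr_ge0 ?mulr_ge0 ?powR_ge0// ltW.
  - by rewrite divr_ge0 ?mulr_ge0 ?powR_ge0// ltW.
  rewrite ler_wpM2l ?mulr_ge0 ?powR_ge0 ?(ltW (B0 j))//.
  rewrite lef_pV2 ?posrE ?mulr_gt0 ?powR_gt0//.
  by rewrite ler_peMl ?powR_ge0.
have mean_le (j : 'I_d) : `|(vexpectation P S - G) ord0 j| <=
    2 * L ^+ 2 * (m%:R * (1 + theta) / (theta ^+ 2 * n%:R) * M j +
      m%:R / (theta ^+ 2 * n%:R) * (M j * D' j)).
  have [_ iY EY] := mom j.
  (* [fine] is additive on finite values only; the integrability of [Y j] provides them. *)
  have -> : (vexpectation P S - G) ord0 j = fine (\int[P]_w (Y j w)%:E)%E.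
    rewrite mxE [(- G) _ _]mxE mxE unlock.
    have SE w : S w ord0 j = Y j w + G ord0 j.
      by have := SY w j; rewrite mxE [(- G) _ _]mxE => <-; rewrite subrK.
    under eq_integral do rewrite SE EFinD.
    rewrite integralD//; last exact: finite_measure_integrable_cst.
    rewrite integral_cst//= probability_setT mule1 fineD ?addrK//.
    exact: integrable_fin_num.
  apply: (le_trans EY); rewrite /median_scale -LE -/(D j).
  set q := theta ^+ 2 * n%:R.
  have q0 : 0 < q by rewrite mulr_gt0// exprn_gt0.
  have -> : 2 * (2 * m).+1%:R * (4 * M j / q) * (2 * (L * (D j + theta))) =
      (L * (M j / q)) * (16 * (2 * m).+1%:R * (D j + theta)) by ring.
  have -> : 2 * L ^+ 2 * (m%:R * (1 + theta) / q * M j + m%:R / q * (M j * D' j)) =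
      (L * (M j / q)) * (2 * L * m%:R * (1 + theta + D' j)) by ring.
  have Mq : 0 <= M j / q by rewrite divr_ge0// ltW.
  apply: ler_wpM2l; first by rewrite mulr_ge0// ltW.
  apply: bias_constant_le => //; first by rewrite D0 DD'.
  by rewrite ler0n/= -natrM ler_nat ltn_pmul2r.
have n2 : 0 <= theta ^+ 2 * n%:R by rewrite mulr_ge0 ?sqr_ge0.
apply: (le_trans (sqrt_sum_sqr_le _ _ _ _ mean_le)) => //.
- by rewrite divr_ge0 ?mulr_ge0 ?addr_ge0 ?(ltW theta0).
- by rewrite divr_ge0.
- by rewrite mulr_ge0 ?sqr_ge0.
- by move=> j; exact: powR_ge0.
rewrite le_eqVlt; apply/orP; left; apply/eqP.
rewrite (mulrA 2 2); congr (_ * _ * (_ + _ * Num.sqrt _)); first by ring.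
by apply: eq_bigr => j _; rewrite sqr_root.
Qed.
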